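(* Let $\lambda\ge 0$, let $\varphi(z)=1+B_1z+B_2z^2+B_3z^3+\cdots$ ($B_1>0$) be an analytic univalent function with positive real part in the open unit disk $\mathbb{D}$, and let $f(z)=z+\sum_{n=2}^\infty a_nz^n$ belong to the class $M_\sigma^\lambda(\varphi)$. Put $$D=B_1^2+(1+\lambda)(B_1-B_2),\qquad E=(9+15\lambda)B_1^2-8(1+2\lambda)(1+\lambda)(B_2-B_1),$$ $$A_1=(B_2-B_1)+\frac{3(1+5\lambda)B_1^2}{8(1+\lambda)(1+2\lambda)}+\frac{B_1(1+\lambda)}{4D}\left((B_1+B_3-2B_2)+\frac{2(1+4\lambda)B_1^3}{(1+\lambda)^3}\right),$$ $$C_1=-\frac{3(1+5\lambda)B_1^2}{8(1+\lambda)(1+2\lambda)}+\frac{B_1(1+\lambda)}{4D}\left((B_1+B_3-2B_2)+\frac{2(1+4\lambda)B_1^3}{(1+\lambda)^3}\right).$$ (a) If $(1+\lambda)B_1\le|D|$, then $$|a_2|\le\frac{B_1\sqrt{B_1}}{\sqrt{(1+\lambda)|D|}},$$ $$|a_3|\le\frac{B_1}{2(1+2\lambda)(1+\lambda)|D|}\min\Big\{\tfrac12\Big(\big|(3+5\lambda)B_1^2+(1+\lambda)^2(B_1-B_2)\big|+\big|(1+3\lambda)B_1^2-(1+\lambda)^2(B_1-B_2)\big|\Big),$$ $$\qquad\big|(1+3\lambda)B_1^2-(1+\lambda)^2(B_1-B_2)\big|+\big|(1+\lambda)B_1^2+(1+\lambda)^2(B_1-B_2)\big|\Big\},$$ $$|a_4|\le\frac{1}{3(1+3\lambda)}\min\Bigg\{B_1+\frac{2\sqrt{(1+\lambda)B_1}}{\sqrt{|D|}}\big(|A_1|+|C_1|\big),$$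 $$\qquad B_1\left(\left|\frac{(12+30\lambda)B_1^2-4(1+\lambda)(1+2\lambda)(B_2-B_1)}{E}\right|+\left|\frac{4(1+\lambda)(1+2\lambda)(B_2-B_1)+3B_1^2(1+5\lambda)}{E}\right|\right)$$ $$\qquad+\frac{2\sqrt{(1+\lambda)B_1}}{\sqrt{|D|}}\left|B_2-B_1+\frac{B_1\big((B_1+B_3-2B_2)(1+\lambda)^3+2(1+4\lambda)B_1^3\big)}{2(1+\lambda)^2D}\right|\Bigg\}.$$ (b) If $(1+\lambda)B_1\ge|D|$, then $$|a_2|\le\frac{B_1}{1+\lambda},$$ $$|a_3|\le\min\Bigg\{\frac{B_1}{4(1+2\lambda)(1+\lambda)|D|}\Big(\big|(3+5\lambda)B_1^2+(1+\lambda)^2(B_1-B_2)\big|+\big|(1+3\lambda)B_1^2-(1+\lambda)^2(B_1-B_2)\big|\Big),$$ $$\qquad\frac{1}{2(1+2\lambda)(1+\lambda)^2}\Big(\big|(1+3\lambda)B_1^2-(1+\lambda)^2(B_1-B_2)\big|+B_1(1+\lambda)^2\Big)\Bigg\},$$ $$|a_4|\le\frac{1}{3(1+3\lambda)}\min\Bigg\{B_1+2\big(|A_1|+|C_1|\big),$$ $$\qquad B_1\left(\left|\frac{(12+30\lambda)B_1^2-4(1+\lambda)(1+2\lambda)(B_2-B_1)}{E}\right|+\left|\frac{4(1+\lambda)(1+2\lambda)(B_2-B_1)+3B_1^2(1+5\lambda)}{E}\right|\right)$$ $$\qquad+2\left|B_2-B_1+\frac{B_1\big((B_1+B_3-2B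_2)(1+\lambda)^3+2(1+4\lambda)B_1^3\big)}{2(1+\lambda)^2D}\right|\Bigg\}.$$
   Context: $\mathbb{D}=\{z\in\mathbb{C}:|z|<1\}$. $\mathcal{A}$ is the class of analytic functions $f$ on $\mathbb{D}$ with $f(0)=0$, $f'(0)=1$. A function $f\in\mathcal{A}$ is bi-univalent if $f$ is univalent (injective) in $\mathbb{D}$ and its inverse $f^{-1}$ (defined near $0$) has a univalent analytic continuation $g$ to $\mathbb{D}$; $\sigma$ denotes the class of bi-univalent functions. For analytic functions $F,G$ on $\mathbb{D}$, $F\prec G$ ($F$ is subordinate to $G$) means there is an analytic $w$ on $\mathbb{D}$ with $w(0)=0$, $|w(z)|<1$ and $F(z)=G(w(z))$. The function $\varphi$ is analytic and univalent in $\mathbb{D}$ with positive real part, $\varphi(0)=1$, $\varphi'(0)=B_1>0$. For $\lambda\ge0$, $M^\lambda(\varphi)$ is the class of $f\in\mathcal{A}$ with $$\lambda\left(1+\frac{zf''(z)}{f'(z)}\right)+(1-\lambda)\frac{zf'(z)}{f(z)}\prec\varphi(z)\quad(z\in\mathbb{D}).$$ $M_\sigma^\lambda(\varphi)$ is the class of $f\in\sigma$ such that both $f$ and $g$ belong to $M^\lambda(\varphi)$, where $g$ is the analytic continuation of $f^{-1}$ to $\mathbb{D}$. Convention: a displayed bound is asserted only when its denominators are nonzero; inside a minimum, an entry having a vanishing denominator is disregarded. *)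

(* Defs.v *)
From Stdlib Require Import Reals.
From Coquelicot Require Import Coquelicot.

Local Open Scope R_scope.

Definition in_disk (z : C) : Prop := Cmod z < 1.

(* Functions on the disk are total functions [C -> C]; every notion below only
   depends on their values in the open unit disk. *)

Definition analytic_on_disk (f : C -> C) : Prop :=
  forall z0 : C, in_disk z0 ->
  exists (c : nat -> C) (r : R), 0 < r /\
    forall z : C, Cmod (z - z0)%C < r ->
      is_pseries (K := C_AbsRing) (V := C_NormedModule) c (z - z0)%C (f z).

Definition taylor_on_disk (f : C -> C) (a : nat -> C) : Prop :=
  forall z : C, in_disk z ->
    is_pseries (K := C_AbsRing) (V := C_NormedModule) a z (f z).

Definition injective_on_disk (f : C -> C) : Prop :=
  forall z1 z2 : C, in_disk z1 -> in_disk z2 -> f z1 = f z2 -> z1 = z2.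

Definition univalent (f : C -> C) : Prop :=
  analytic_on_disk f /\ injective_on_disk f.

Definition class_A (f : C -> C) : Prop :=
  analytic_on_disk f /\ f (RtoC 0) = RtoC 0 /\ C_derive f (RtoC 0) = RtoC 1.

(* When [f] is injective on the disk, the last clause says that [g] coincides
   with the inverse of [f : disk -> f(disk)] in a neighbourhood of 0. *)
Definition inverse_continuation (f g : C -> C) : Prop :=
  univalent g /\
  exists r : R, 0 < r /\
    forall w : C, Cmod w < r -> in_disk (g w) /\ f (g w) = w.

Definition bi_univalent (f : C -> C) : Prop :=
  class_A f /\ univalent f /\ exists g : C -> C, inverse_continuation f g.

Definition subordinate (F G : C -> C) : Prop :=
  exists w : C -> C,
    analytic_on_disk w /\ w (RtoC 0) = RtoC 0 /\
    (forall z : C, in_disk z -> Cmod (w z) < 1) /\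
    (forall z : C, in_disk z -> F z = G (w z)).

(* z f'(z) / f(z), with its removable singularity at 0 filled in: for [f] in
   [class_A] the limit there is 1. *)
Definition starlike_quotient (f : C -> C) (z : C) : C :=
  if Ceq_dec z (RtoC 0) then RtoC 1 else (z * C_derive f z / f z)%C.

Definition convex_quotient (f : C -> C) (z : C) : C :=
  (1 + z * C_derive (C_derive f) z / C_derive f z)%C.

(* Division by zero being total in Rocq, the clause on [f] and [f'] makes
   explicit that both quotients are defined on the whole disk.  It holds
   automatically when [f] is univalent with [f 0 = 0]. *)
Definition class_M (lam : R) (phi f : C -> C) : Prop :=
  class_A f /\
  (forall z : C, in_disk z ->
     C_derive f z <> RtoC 0 /\ (z <> RtoC 0 -> f z <> RtoC 0)) /\
  subordinate
    (fun z : C => (lam * convex_quotient f z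
                   + (1 - lam) * starlike_quotient f z)%C)
    phi.

Definition class_M_sigma (lam : R) (phi f : C -> C) : Prop :=
  bi_univalent f /\ class_M lam phi f /\
  exists g : C -> C, inverse_continuation f g /\ class_M lam phi g.

(* An entry [v] of a minimum, whose denominators have product [den]: it is
   disregarded, i.e. replaced by [+oo], when a denominator vanishes. *)
Definition min_entry (den : C) (v : R) : Rbar :=
  if Ceq_dec den (RtoC 0) then p_infty else Finite v.

(* Main.v *)
Require Import Defs.
From Stdlib Require Import Reals Lra Lia List Classical ClassicalEpsilon.
From Coquelicot Require Import Coquelicot.

Local Open Scope R_scope.

(** Write the subordination for [f] as [F = phi o w] with a Schwarz function [w],
    and the one for [g], the inverse of [f], with a Schwarz function [v].
    Comparing the first three Taylor coefficients on both sides, for [f] and for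
    [g], gives six polynomial relations ([class_M_relations]) between
    [a2], [a3], [a4] and the half coefficients [P1], [P2], [P3] of
    [(1 + w) / (1 - w)] and [Q1], [Q2], [Q3] of [(1 + v) / (1 - v)], once the
    coefficients of [g] are expressed by those of [f] ([inverse_coefficients]).
    These quotients have positive real part, so by Caratheodory's theorem all six
    numbers have modulus at most 1 ([schwarz_coefficients]).  Each entry of the
    minima then comes from writing [a3] or [a4] as a linear combination of [P2],
    [Q2], [P3], [Q3] in one of the possible ways and applying the triangle
    inequality.  The two cases of the theorem differ only in the bound used for
    [P1]: the elimination also gives [2 D P1^2 = (1 + lam) B1 (P2 + Q2)], hence
    [|P1|^2 <= (1 + lam) B1 / |D|] besides [|P1| <= 1].

    Caratheodory's bound is obtained without integration.  Averaging a function
    over the rotations by the [n]-th roots of unity keeps its real part positive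
    and removes the coefficients of order 1, ..., n-1, which reduces the bound on
    the [n]-th coefficient to Schwarz's lemma for a zero of order [n]
    ([schwarz_order]).  That lemma rests on a maximum principle
    ([maximum_principle]) for functions having at each point a Taylor expansion
    of order 2 with cubic error.  Such functions are closed under the algebraic
    operations needed, quotients included, by induction on the order
    ([jet_mult], [jet_inv]); no power series of a quotient has to be formed. *)

(** * Taylor expansions of finite order *)

Definition near0 (P : C -> Prop) : Prop :=
  exists d : R, 0 < d /\ forall t : C, Cmod t < d -> P t.

Lemma near0_and (P Q : C -> Prop) :
  near0 P -> near0 Q -> near0 (fun t => P t /\ Q t).
Proof.
  intros [d [Hd HP]] [e [He HQ]].
  exists (Rmin d e); split; [now apply Rmin_glb_lt|].
  intros t Ht; split; [apply HP | apply HQ];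
    (eapply Rlt_le_trans; [exact Ht|]); [apply Rmin_l | apply Rmin_r].
Qed.

Lemma near0_imp (P Q : C -> Prop) :
  (forall t, P t -> Q t) -> near0 P -> near0 Q.
Proof. intros H [d [Hd HP]]; exists d; auto. Qed.

Lemma near0_true (P : C -> Prop) : (forall t, P t) -> near0 P.
Proof. intros H; exists 1; split; [lra | auto]. Qed.

(** [jet N c h]: [h t = c 0 + c 1 t + ... + c (N-1) t^(N-1) + O(t^N)] at the origin.
    The recursive form, with the quotient [(h t - c 0) / t] having a jet of order
    one less, turns every closure property below into a short induction. *)
Fixpoint jet (N : nat) (c : nat -> C) (h : C -> C) : Prop :=
  match N with
  | O => exists M : R, near0 (fun t => Cmod (h t) <= M)
  | S n => exists k : C -> C,
      near0 (fun t => h t = (c O + t * k t)%C) /\ jet n (fun i => c (S i)) k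
  end.

Lemma jet_ext (N : nat) (c c' : nat -> C) (h h' : C -> C) :
  (forall i, (i < N)%nat -> c i = c' i) -> near0 (fun t => h t = h' t) ->
  jet N c h -> jet N c' h'.
Proof.
  revert c c' h h'; induction N as [|N IH]; intros c c' h h' Hc Hh.
  - intros [M HM]; exists M.
    apply (near0_imp (fun t => h t = h' t /\ Cmod (h t) <= M)).
    + intros t [E L]; now rewrite <- E.
    + now apply near0_and.
  - intros [k [Hk Jk]]; exists k; split.
    + apply (near0_imp (fun t => h t = h' t /\ h t = (c O + t * k t)%C)).
      * intros t [E L]; rewrite <- E, L, (Hc O); [reflexivity | lia].
      * now apply near0_and.
    + apply (IH (fun i => c (S i)) _ k); auto.
      * intros i Hi; apply Hc; lia.
      * now apply near0_true.
Qed.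

Lemma jet_near (N : nat) (c : nat -> C) (h h' : C -> C) :
  near0 (fun t => h t = h' t) -> jet N c h -> jet N c h'.
Proof. now apply jet_ext. Qed.

Lemma jet_head (N : nat) (c : nat -> C) (h : C -> C) :
  jet (S N) c h -> h (RtoC 0) = c O.
Proof.
  intros [k [[d [Hd Hk]] _]].
  rewrite Hk; [ring | now rewrite Cmod_0].
Qed.

Lemma jet_bounded (N : nat) (c : nat -> C) (h : C -> C) :
  jet N c h -> exists M : R, 0 < M /\ near0 (fun t => Cmod (h t) <= M).
Proof.
  revert c h; induction N as [|N IH]; intros c h.
  - intros [M HM]; exists (Rmax M 1); split.
    + apply Rlt_le_trans with 1; [lra | apply Rmax_r].
    + revert HM; apply near0_imp; intros t Ht.
      apply Rle_trans with M; [exact Ht | apply Rmax_l].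
  - intros [k [Hk Jk]]. destruct (IH _ _ Jk) as [M [HM Hb]].
    exists (Cmod (c O) + M); split.
    + generalize (Cmod_ge_0 (c O)); lra.
    + assert (H1 : near0 (fun t => Cmod t <= 1)) by (exists 1; split; [lra | intros; lra]).
      generalize (near0_and _ _ H1 (near0_and _ _ Hk Hb)); apply near0_imp.
      intros t [H [E L]]; rewrite E.
      eapply Rle_trans; [apply Cmod_triangle | apply Rplus_le_compat_l].
      rewrite Cmod_mult.
      generalize (Cmod_ge_0 t) (Cmod_ge_0 (k t)); nra.
Qed.

Lemma jet_lower (N n : nat) (c : nat -> C) (h : C -> C) :
  (n <= N)%nat -> jet N c h -> jet n c h.
Proof.
  revert n c h; induction N as [|N IH]; intros n c h Hn J.
  - now replace n with O by lia.
  - destruct n as [|n].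
    + destruct (jet_bounded _ _ _ J) as [M [_ H]]; now exists M.
    + destruct J as [k [Hk Jk]]; exists k; split; auto.
      apply IH; [lia | auto].
Qed.

Lemma jet_small (N : nat) (c : nat -> C) (h : C -> C) :
  jet (S N) c h -> forall eps, 0 < eps ->
  near0 (fun t => Cmod (h t - c O) < eps).
Proof.
  intros [k [Hk Jk]] eps He.
  destruct (jet_bounded _ _ _ Jk) as [M [HM Hb]].
  assert (H1 : near0 (fun t => Cmod t < eps / M)).
  { exists (eps / M); split; [now apply Rdiv_lt_0_compat | auto]. }
  generalize (near0_and _ _ H1 (near0_and _ _ Hk Hb)); apply near0_imp.
  intros t [H [E L]]; rewrite E.
  replace (c O + t * k t - c O)%C with (t * k t)%C by ring.
  rewrite Cmod_mult.
  apply Rle_lt_trans with (Cmod t * M).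
  - apply Rmult_le_compat_l; [apply Cmod_ge_0 | exact L].
  - apply Rlt_le_trans with (eps / M * M); [now apply Rmult_lt_compat_r|].
    right; field; lra.
Qed.

Definition const_seq (x : C) (n : nat) : C :=
  match n with O => x | S _ => RtoC 0 end.

Lemma jet_zero (N : nat) : jet N (fun _ => RtoC 0) (fun _ => RtoC 0).
Proof.
  induction N as [|N IH].
  - exists 0; apply near0_true; intros _; rewrite Cmod_0; lra.
  - exists (fun _ => RtoC 0); split; [apply near0_true; intros t; ring | exact IH].
Qed.

Lemma jet_const (N : nat) (x : C) : jet N (const_seq x) (fun _ => x).
Proof.
  destruct N as [|N].
  - exists (Cmod x); apply near0_true; intros _; lra.
  - exists (fun _ => RtoC 0); split; [apply near0_true; intros t; simpl; ring|].
    apply jet_zero.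
Qed.

Lemma jet_mul_id (N : nat) (c : nat -> C) (h : C -> C) :
  jet N c h ->
  jet (S N) (fun i => match i with O => RtoC 0 | S j => c j end)
      (fun t => (t * h t)%C).
Proof.
  intros J; exists h; split; [apply near0_true; intros t; ring | exact J].
Qed.

Lemma jet_plus (N : nat) (c c' : nat -> C) (h h' : C -> C) :
  jet N c h -> jet N c' h' ->
  jet N (fun i => (c i + c' i)%C) (fun t => (h t + h' t)%C).
Proof.
  revert c c' h h'; induction N as [|N IH]; intros c c' h h'.
  - intros [M HM] [M' HM']; exists (M + M').
    generalize (near0_and _ _ HM HM'); apply near0_imp; intros t [H H'].
    eapply Rle_trans; [apply Cmod_triangle | lra].
  - intros [k [Hk Jk]] [k' [Hk' Jk']].
    exists (fun t => (k t + k' t)%C); split; [|now apply (IH (fun i => c (S i)) (fun i => c' (S i)))].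
    generalize (near0_and _ _ Hk Hk'); apply near0_imp; intros t [-> ->]; ring.
Qed.

(** The Cauchy product, organised so that dropping its head term is again a sum
    of a scaling and a Cauchy product; that is the shape in which products of
    Taylor expansions are computed. *)
Fixpoint cauchy_mul (c c' : nat -> C) (n : nat) {struct n} : C :=
  match n with
  | O => (c O * c' O)%C
  | S m => (c O * c' (S m) + cauchy_mul (fun i => c (S i)) c' m)%C
  end.

Lemma jet_scal (N : nat) (x : C) (c : nat -> C) (h : C -> C) :
  jet N c h -> jet N (fun i => (x * c i)%C) (fun t => (x * h t)%C).
Proof.
  revert c h; induction N as [|N IH]; intros c h.
  - intros [M HM]; exists (Cmod x * M); revert HM; apply near0_imp; intros t H.
    rewrite Cmod_mult; apply Rmult_le_compat_l; [apply Cmod_ge_0 | exact H].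
  - intros [k [Hk Jk]]; exists (fun t => (x * k t)%C); split; [|now apply (IH (fun i => c (S i)))].
    revert Hk; apply near0_imp; intros t ->; ring.
Qed.

Lemma jet_mult (N : nat) (c c' : nat -> C) (h h' : C -> C) :
  jet N c h -> jet N c' h' -> jet N (cauchy_mul c c') (fun t => (h t * h' t)%C).
Proof.
  revert c h; induction N as [|N IH]; intros c h J J'.
  - destruct (jet_bounded _ _ _ J) as [M [HM Hb]].
    destruct (jet_bounded _ _ _ J') as [M' [HM' Hb']].
    exists (M * M'); generalize (near0_and _ _ Hb Hb'); apply near0_imp.
    intros t [H H']; rewrite Cmod_mult.
    apply Rmult_le_compat; auto using Cmod_ge_0.
  - destruct J as [k [Hk Jk]].
    assert (Jl : jet N c' h') by (apply jet_lower with (S N); [lia | exact J']).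
    destruct J' as [k' [Hk' Jk']].
    exists (fun t => (c O * k' t + k t * h' t)%C); split.
    + generalize (near0_and _ _ Hk Hk'); apply near0_imp; intros t [E E'].
      rewrite E, E'; simpl; ring.
    + apply jet_plus with (c := fun i => (c O * c' (S i))%C)
                          (c' := cauchy_mul (fun i => c (S i)) c').
      * now apply jet_scal with (c := fun i => c' (S i)).
      * now apply IH.
Qed.

(** [N] is the order of the expansion and drives the recursion: the recursive call
    is passed as a whole sequence to [cauchy_mul], so that recursion on the index
    [n] would not be structural. *)
Fixpoint compose_seq (N : nat) (c d : nat -> C) (n : nat) {struct N} : C :=
  match N, n with
  | S N', S m =>
      cauchy_mul (fun i => d (S i)) (compose_seq N' (fun i => c (S i)) d) m
  | _, _ => c O
  end.

Lemma jet_comp (N : nat) (c d : nat -> C) (F G : C -> C) :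
  jet N c F -> jet (S N) d G -> d O = RtoC 0 ->
  jet N (compose_seq N c d) (fun t => F (G t)).
Proof.
  intros JF JG Hd; revert c F JF; induction N as [|N IH]; intros c F JF.
  - destruct JF as [M [r [Hr HM]]]; exists M.
    generalize (jet_small _ _ _ JG r Hr); apply near0_imp; intros t Ht.
    apply HM. rewrite Hd in Ht. now replace (G t) with (G t - RtoC 0)%C by ring.
  - destruct JF as [K [[r [Hr HK]] JK]].
    assert (JG' : jet (S N) d G) by (apply jet_lower with (S (S N)); [lia | exact JG]).
    assert (Hs := jet_small _ _ _ JG r Hr).
    specialize (IH JG' _ _ JK).
    destruct JG' as [k [Hk Jk]].
    exists (fun t => (k t * K (G t))%C); split.
    + generalize (near0_and _ _ Hs Hk); apply near0_imp; intros t [Ht E].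
      rewrite HK.
      * rewrite E at 1. rewrite Hd; simpl; ring.
      * rewrite Hd in Ht. now replace (G t) with (G t - RtoC 0)%C by ring.
    + simpl. now apply jet_mult.
Qed.

(** Induction on the order through
    [1 / (c + t k) = 1 / c - (t / c) k (1 / (c + t k))]: the jet of [1 / h] of order
    [n + 1] only needs the one of order [n]. *)
Lemma jet_inv (N : nat) (c : nat -> C) (h : C -> C) :
  jet (S N) c h -> c O <> RtoC 0 ->
  exists d, jet (S N) d (fun t => (/ h t)%C).
Proof.
  intros J Hc.
  assert (Hpos : 0 < Cmod (c O)) by now apply Cmod_gt_0.
  assert (Hlow : near0 (fun t => Cmod (c O) / 2 <= Cmod (h t))).
  { generalize (jet_small _ _ _ J (Cmod (c O) / 2) ltac:(lra)).
    apply near0_imp; intros t Ht.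
    generalize (Cmod_triangle (h t) (- (h t - c O))%C); rewrite Cmod_opp.
    replace (h t + - (h t - c O))%C with (c O) by ring; lra. }
  assert (Hnz : near0 (fun t => h t <> RtoC 0)).
  { revert Hlow; apply near0_imp; intros t Ht.
    apply Cmod_gt_0; lra. }
  assert (Hgen : forall n, (n <= S N)%nat -> exists d, jet n d (fun t => (/ h t)%C)).
  { induction n as [|n IH]; intros Hn.
    - exists (fun _ => RtoC 0); exists (/ (Cmod (c O) / 2)).
      generalize (near0_and _ _ Hlow Hnz); apply near0_imp; intros t [Ht Hz].
      rewrite Cmod_inv; [|exact Hz].
      apply Rinv_le_contravar; [lra | exact Ht].
    - destruct IH as [d Jd]; [lia|].
      assert (Jh : jet (S n) c h) by now apply jet_lower with (S N).
      destruct Jh as [k [Hk Jk]].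
      exists (fun i => match i with O => (/ c O)%C
               | S j => (- / c O * cauchy_mul (fun i => c (S i)) d j)%C end).
      exists (fun t => (- / c O * (k t * / h t))%C); split.
      + generalize (near0_and _ _ Hk Hnz); apply near0_imp; intros t [E Hz].
        rewrite E in Hz |- *; field; auto.
      + apply jet_scal, jet_mult; [exact Jk | exact Jd]. }
  now apply Hgen.
Qed.

Lemma jet_rescale (N : nat) (x : C) (c : nat -> C) (h : C -> C) :
  jet N c h -> jet N (fun i => (c i * x ^ i)%C) (fun t => h (x * t)%C).
Proof.
  assert (Hn : forall P, near0 P -> near0 (fun t => P (x * t)%C)).
  { intros P [d [Hd HP]].
    exists (d / (Cmod x + 1)); generalize (Cmod_ge_0 x); intros Hx; split.
    - apply Rdiv_lt_0_compat; lra.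
    - intros t Ht; apply HP; rewrite Cmod_mult.
      apply Rle_lt_trans with ((Cmod x + 1) * Cmod t).
      + generalize (Cmod_ge_0 t); nra.
      + apply (Rmult_lt_compat_l (Cmod x + 1)) in Ht; [|lra].
        replace d with ((Cmod x + 1) * (d / (Cmod x + 1))) by (field; lra).
        exact Ht. }
  revert c h; induction N as [|N IH]; intros c h.
  - intros [M HM]; exists M; now apply (Hn (fun t => Cmod (h t) <= M)).
  - intros [k [Hk Jk]]; exists (fun t => (x * k (x * t))%C); split.
    + apply Hn in Hk; revert Hk; apply near0_imp; intros t ->; simpl; ring.
    + apply jet_ext with (c := fun i => (x * (c (S i) * x ^ i))%C)
                         (h := fun t => (x * k (x * t))%C).
      * intros i _; simpl; ring.
      * now apply near0_true.
      * apply jet_scal, IH, Jk.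
Qed.

Lemma Cmod_zero_of_small (x : C) :
  (exists M d, 0 < M /\ 0 < d /\ forall t : R, 0 < t < d -> Cmod x <= M * t) ->
  x = RtoC 0.
Proof.
  intros [M [d [HM [Hd H]]]].
  apply Cmod_eq_0.
  destruct (Rle_lt_or_eq_dec 0 (Cmod x) (Cmod_ge_0 x)) as [Hx|Hx]; [|auto].
  exfalso.
  set (t := Rmin (d / 2) (Cmod x / (2 * M))).
  assert (Ht : 0 < t).
  { apply Rmin_glb_lt; [lra | apply Rdiv_lt_0_compat; lra]. }
  assert (Ht1 : t <= d / 2) by apply Rmin_l.
  assert (Ht2 : t <= Cmod x / (2 * M)) by apply Rmin_r.
  assert (Hle := H t ltac:(lra)).
  apply (Rmult_le_compat_l M) in Ht2; [|lra].
  replace (M * (Cmod x / (2 * M))) with (Cmod x / 2) in Ht2 by (field; lra).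
  lra.
Qed.

(** Agreement off the origin suffices, which is what makes the induction go
    through: the quotients [(h t - c 0) / t] are only determined there. *)
Lemma jet_unique (N : nat) (c c' : nat -> C) (h h' : C -> C) :
  jet N c h -> jet N c' h' ->
  near0 (fun t => t <> RtoC 0 -> h t = h' t) ->
  forall i, (i < N)%nat -> c i = c' i.
Proof.
  revert c c' h h'; induction N as [|N IH]; intros c c' h h' J J' He i Hi; [lia|].
  destruct J as [k [Hk Jk]]; destruct J' as [k' [Hk' Jk']].
  assert (H0 : c O = c' O).
  { apply Ceq_minus, Cmod_zero_of_small.
    destruct (jet_bounded _ _ _ Jk) as [M [HM Hb]].
    destruct (jet_bounded _ _ _ Jk') as [M' [HM' Hb']].
    destruct (near0_and _ _ He (near0_and _ _ (near0_and _ _ Hk Hk')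
                (near0_and _ _ Hb Hb'))) as [d [Hd H]].
    exists (M + M'), d; split; [lra | split; [exact Hd|]].
    intros t [Ht0 Ht].
    assert (Hm : Cmod (RtoC t) = t) by (rewrite Cmod_R; apply Rabs_pos_eq; lra).
    destruct (H (RtoC t)) as [E [[E1 E2] [L1 L2]]]; [now rewrite Hm|].
    assert (Hz : RtoC t <> RtoC 0) by (intros Z; apply RtoC_inj in Z; lra).
    specialize (E Hz); rewrite E1, E2 in E.
    assert (E' : (c O - c' O)%C = (RtoC t * (k' (RtoC t) - k (RtoC t)))%C).
    { apply Ceq_minus; apply Ceq_minus in E; rewrite <- E; ring. }
    rewrite E', Cmod_mult, Hm, Rmult_comm.
    apply Rmult_le_compat_r; [lra|].
    eapply Rle_trans; [apply Cmod_triangle|]; rewrite Cmod_opp; lra. }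
  destruct i as [|i]; [exact H0|].
  apply (IH (fun i => c (S i)) (fun i => c' (S i)) k k' Jk Jk'); [|lia].
  generalize (near0_and _ _ He (near0_and _ _ Hk Hk')); apply near0_imp.
  intros t [E [E1 E2]] Ht; specialize (E Ht).
  rewrite E1, E2, H0 in E.
  replace (k t) with (/ t * ((c' O + t * k t) - c' O))%C by (field; auto).
  rewrite E; field; auto.
Qed.

(** * Power series near the origin *)

Definition C_series (u : nat -> C) (l : C) : Prop :=
  is_series (K := C_AbsRing) (V := C_NormedModule) u l.

Lemma C_pseries_series (c : nat -> C) (z l : C) :
  is_pseries (K := C_AbsRing) (V := C_NormedModule) c z l <->
  C_series (fun n => (z ^ n * c n)%C) l.
Proof.
  split; intros H; revert H; apply is_series_ext; reflexivity.
Qed.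

Lemma C_series_plus (u v : nat -> C) (l m : C) :
  C_series u l -> C_series v m -> C_series (fun n => (u n + v n)%C) (l + m)%C.
Proof. apply (is_series_plus (K := C_AbsRing) (V := C_NormedModule)). Qed.

Lemma C_series_scal (x : C) (u : nat -> C) (l : C) :
  C_series u l -> C_series (fun n => (x * u n)%C) (x * l)%C.
Proof. apply (is_series_scal (K := C_AbsRing) (V := C_NormedModule)). Qed.

Lemma is_series_half (M : R) :
  is_series (fun n => M * (1 / 2) ^ n) (M * / (1 - 1 / 2)).
Proof.
  apply (is_series_scal (K := R_AbsRing) (V := R_NormedModule) M).
  apply is_series_geom; rewrite Rabs_pos_eq; lra.
Qed.

Lemma C_series_geom_le (u : nat -> C) (l : C) (M : R) :
  C_series u l -> (forall n, Cmod (u n) <= M * (1 / 2) ^ n) -> Cmod l <= 2 * M.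
Proof.
  intros Hu Hb.
  assert (Hg : is_series (fun n => M * (1 / 2) ^ n) (M * / (1 - 1 / 2))).
  { apply is_series_half. }
  replace (2 * M) with (M * / (1 - 1 / 2)) by field.
  assert (Hn : is_lim_seq (fun n => Cmod (sum_n u n)) (Cmod l)).
  { exact (filterlim_comp _ _ _ _ _ _ _ _ Hu
             (filterlim_norm (V := C_NormedModule) l)). }
  assert (L : Rbar_le (Cmod l) (M * / (1 - 1 / 2))); [|exact L].
  refine (is_lim_seq_le (fun n => Cmod (sum_n (G := C_NormedModule) u n))
            (sum_n (fun n => M * (1 / 2) ^ n)) _
            (Finite (M * / (1 - 1 / 2))) _ Hn Hg).
  intros n.
  eapply Rle_trans; [apply (norm_sum_n_m (V := C_NormedModule) u 0 n)|].
  now apply sum_n_m_le.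
Qed.

Lemma C_series_geom_ex (u : nat -> C) (M : R) :
  (forall n, Cmod (u n) <= M * (1 / 2) ^ n) -> exists l, C_series u l.
Proof.
  intros Hb.
  apply (ex_series_le (V := C_CompleteNormedModule) u (fun n => M * (1 / 2) ^ n)).
  - exact Hb.
  - exists (M * / (1 - 1 / 2)).
    apply is_series_half.
Qed.

Lemma C_series_term_bounded (u : nat -> C) (l : C) :
  C_series u l -> exists M, 0 < M /\ forall n, Cmod (u n) <= M.
Proof.
  intros Hu.
  destruct (filterlim_bounded (V := C_NormedModule) (sum_n u)) as [M HM].
  { now exists l. }
  assert (HM' : forall n, Cmod (sum_n (G := C_NormedModule) u n) <= M) by exact HM.
  clear HM.
  assert (HM0 := Rle_trans _ _ _ (Cmod_ge_0 _) (HM' O)).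
  exists (M + M + 1); split; [lra|].
  intros [|n].
  - generalize (HM' O); rewrite sum_O; lra.
  - replace (u (S n)) with (sum_n (G := C_NormedModule) u (S n)
                            + - sum_n (G := C_NormedModule) u n)%C.
    + eapply Rle_trans; [apply Cmod_triangle|]; rewrite Cmod_opp.
      generalize (HM' n) (HM' (S n)); lra.
    + rewrite sum_Sn; change plus with Cplus; ring.
Qed.

Definition near_pseries (c : nat -> C) (h : C -> C) : Prop :=
  near0 (fun t => is_pseries (K := C_AbsRing) (V := C_NormedModule) c t (h t)).

(** Convergence at one real point [rho] bounds every coefficient by
    [M / rho^n]: all later estimates compare with a geometric series. *)
Lemma near_pseries_coef (c : nat -> C) (h : C -> C) :
  near_pseries c h ->
  exists rho M, 0 < rho /\ 0 < M /\ (forall n, Cmod (c n) * rho ^ n <= M) /\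
    forall t, Cmod t < 2 * rho -> C_series (fun n => (t ^ n * c n)%C) (h t).
Proof.
  intros [d [Hd H]].
  assert (Hm : Cmod (RtoC (d / 2)) = d / 2) by (rewrite Cmod_R, Rabs_pos_eq; lra).
  assert (Hs := H (RtoC (d / 2)) ltac:(lra)).
  apply C_pseries_series in Hs.
  destruct (C_series_term_bounded _ _ Hs) as [M [HM Hb]].
  exists (d / 2), M; repeat split; [lra | exact HM | |].
  - intros n; generalize (Hb n); rewrite Cmod_mult, Cmod_pow, Hm; lra.
  - intros t Ht; apply C_pseries_series, H; lra.
Qed.

Lemma near_pseries_of_taylor (h : C -> C) (c : nat -> C) :
  taylor_on_disk h c -> near_pseries c h.
Proof. intros H; exists 1; split; [lra | exact H]. Qed.

Lemma near_pseries_of_analytic (h : C -> C) (z : C) :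
  analytic_on_disk h -> in_disk z ->
  exists c, near_pseries c (fun t => h (z + t)%C).
Proof.
  intros Ha Hz; destruct (Ha z Hz) as [c [r [Hr Hs]]].
  exists c, r; split; [exact Hr|]; intros t Ht.
  assert (Et : (z + t - z)%C = t) by ring.
  generalize (Hs (z + t)%C); rewrite Et; auto.
Qed.

Lemma near_pseries_of_analytic_0 (h : C -> C) :
  analytic_on_disk h -> exists c, near_pseries c h.
Proof.
  intros Ha.
  destruct (near_pseries_of_analytic h (RtoC 0) Ha) as [c Hc];
    [unfold in_disk; rewrite Cmod_0; lra|].
  exists c; revert Hc; apply near0_imp; intros t; now rewrite Cplus_0_l.
Qed.

Lemma near_pseries_bounded (c : nat -> C) (h : C -> C) :
  near_pseries c h -> exists M, near0 (fun t => Cmod (h t) <= M).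
Proof.
  intros H; destruct (near_pseries_coef _ _ H) as [rho [M [Hr [HM [Hb Hs]]]]].
  exists (2 * M), (rho / 2); split; [lra|]; intros t Ht.
  apply (C_series_geom_le _ _ M (Hs t ltac:(lra))).
  intros n; rewrite Cmod_mult, Cmod_pow.
  apply Rle_trans with ((rho / 2) ^ n * Cmod (c n)).
  - apply Rmult_le_compat_r; [apply Cmod_ge_0|].
    apply pow_incr; generalize (Cmod_ge_0 t); lra.
  - replace (rho / 2) with (rho * (1 / 2)) by field.
    rewrite Rpow_mult_distr.
    generalize (Hb n) (pow_lt (1 / 2) n ltac:(lra)); nra.
Qed.

Lemma near_pseries_jet (N : nat) (c : nat -> C) (h : C -> C) :
  near_pseries c h -> jet N c h.
Proof.
  revert c h; induction N as [|N IH]; intros c h H.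
  - now apply near_pseries_bounded in H.
  - exists (fun t => if Ceq_dec t (RtoC 0) then c 1%nat else ((h t - c O) / t)%C).
    assert (H0 : h (RtoC 0) = c O).
    { destruct H as [d [Hd H]].
      refine (filterlim_locally_unique (V := C_NormedModule) (F := eventually)
                _ _ _ (H (RtoC 0) _) _); [now rewrite Cmod_0|].
      apply (is_pseries_0 (K := C_AbsRing) (V := C_NormedModule)). }
    split.
    + apply near0_true; intros t; destruct (Ceq_dec t (RtoC 0)) as [->|Ht].
      * rewrite H0; ring.
      * field; auto.
    + apply IH; revert H; apply near0_imp; intros t Hs.
      destruct (Ceq_dec t (RtoC 0)) as [->|Ht].
      * apply (is_pseries_0 (K := C_AbsRing) (V := C_NormedModule)
                 (fun i => c (S i))).
      * replace ((h t - c O) / t)%C with (/ t * (h t + - c O))%C by (field; auto).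
        apply (is_pseries_decr_1 (K := C_AbsRing) (V := C_NormedModule) c t (/ t)%C (h t));
          [|exact Hs].
        now apply Cinv_l.
Qed.

Lemma INR_le_pow2 (n : nat) : INR (S n) <= 2 ^ S n.
Proof.
  induction n as [|n IH]; [simpl; lra|].
  rewrite S_INR; change (2 ^ S (S n)) with (2 * 2 ^ S n).
  assert (1 <= 2 ^ S n) by (apply pow_R1_Rle; lra); lra.
Qed.

(** Remainder of the first-order expansion of [z^n]; the [2^n] stands for the
    sum of the binomial coefficients. *)
Lemma pow_expand_bound (z t : C) (r : R) (n : nat) :
  0 < r -> Cmod z <= r -> Cmod (z + t)%C <= r ->
  Cmod ((z + t) ^ S n - z ^ S n - t * (INR (S n) * z ^ n))%C * r
    <= Cmod t ^ 2 * (2 * r) ^ n * 2.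
Proof.
  intros Hr Hz Hzt.
  induction n as [|n IH].
  - replace ((z + t) ^ 1 - z ^ 1 - t * (INR 1 * z ^ 0))%C with (RtoC 0).
    + rewrite Cmod_0; simpl; generalize (Cmod_ge_0 t); nra.
    + simpl; ring.
  - replace ((z + t) ^ S (S n) - z ^ S (S n) - t * (INR (S (S n)) * z ^ S n))%C
      with ((z + t) * ((z + t) ^ S n - z ^ S n - t * (INR (S n) * z ^ n))
            + INR (S n) * (t ^ 2 * z ^ n))%C.
    2:{ rewrite (S_INR (S n)), RtoC_plus; simpl; ring. }
    set (d := ((z + t) ^ S n - z ^ S n - t * (INR (S n) * z ^ n))%C) in *.
    apply Rle_trans with ((Cmod (z + t)%C * Cmod d + INR (S n) * (Cmod t ^ 2 * Cmod z ^ n)) * r).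
    { apply Rmult_le_compat_r; [lra|].
      eapply Rle_trans; [apply Cmod_triangle|].
      rewrite !Cmod_mult, !Cmod_pow, Cmod_R, (Rabs_pos_eq (INR (S n))) by apply pos_INR.
      lra. }
    assert (Hzn : Cmod z ^ n <= r ^ n) by (apply pow_incr; generalize (Cmod_ge_0 z); lra).
    assert (Ht2 : 0 <= Cmod t ^ 2) by apply pow2_ge_0.
    assert (Hn := INR_le_pow2 n).
    assert (Hrn : 0 < r ^ n) by now apply pow_lt.
    assert (H1 : Cmod (z + t)%C * Cmod d * r <= r * (Cmod t ^ 2 * (2 * r) ^ n * 2)).
    { rewrite Rmult_assoc; apply Rmult_le_compat; auto using Cmod_ge_0.
      generalize (Cmod_ge_0 d); nra. }
    assert (H2 : INR (S n) * (Cmod t ^ 2 * Cmod z ^ n) <= 2 ^ S n * (Cmod t ^ 2 * r ^ n)).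
    { apply Rmult_le_compat; auto using pos_INR.
      - apply Rmult_le_pos; [exact Ht2 | apply pow_le, Cmod_ge_0].
      - apply Rmult_le_compat_l; auto. }
    apply (Rmult_le_compat_r r) in H2; [|lra].
    rewrite Rpow_mult_distr in H1 |- *.
    simpl pow in *. simpl in H2 |- *.
    nra.
Qed.

(** Termwise differentiation.  Summing [pow_expand_bound] against the coefficient
    bounds gives [|h (z + t) - h z - t l| <= K |t|^2] on a small disk, where [l] is
    the sum of the differentiated series. *)
Lemma near_pseries_derive (c : nat -> C) (h : C -> C) :
  near_pseries c h ->
  near_pseries (fun n => (INR (S n) * c (S n))%C) (C_derive h).
Proof.
  intros H; destruct (near_pseries_coef _ _ H) as [rho [M [Hr [HM [Hb Hs]]]]].
  assert (Hex : forall z, Cmod z < rho / 4 ->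
            exists l, C_series (fun n => (z ^ n * (INR (S n) * c (S n)))%C) l).
  { intros z Hz. apply C_series_geom_ex with (2 * M / rho); intros n.
    rewrite !Cmod_mult, Cmod_pow, Cmod_R, (Rabs_pos_eq (INR (S n))) by apply pos_INR.
    assert (Hn := INR_le_pow2 n).
    assert (Hzn : Cmod z ^ n <= (rho / 4) ^ n)
      by (apply pow_incr; generalize (Cmod_ge_0 z); lra).
    assert (Hbn : Cmod (c (S n)) <= M / rho ^ S n).
    { apply Rle_div_r; [now apply pow_lt | apply Hb]. }
    apply Rle_trans with ((rho / 4) ^ n * (2 ^ S n * (M / rho ^ S n))).
    - apply Rmult_le_compat; auto.
      + apply pow_le, Cmod_ge_0.
      + apply Rmult_le_pos; [apply pos_INR | apply Cmod_ge_0].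
      + apply Rmult_le_compat; auto using pos_INR, Cmod_ge_0.
    - right. replace (rho / 4) with (rho * (1 / 2) * (1 / 2)) by field.
      rewrite !Rpow_mult_distr.
      replace (2 ^ S n) with (2 / (1 / 2) ^ n).
      + simpl; field; repeat split; try lra; apply Rgt_not_eq, pow_lt; lra.
      + unfold Rdiv; rewrite Rmult_1_l, pow_inv, Rinv_inv; reflexivity. }
  exists (rho / 4); split; [lra|]; intros z Hz.
  destruct (Hex z Hz) as [l Hl].
  replace (C_derive h z) with l; [now apply C_pseries_series|].
  symmetry; apply is_C_derive_unique.
  set (r := rho / 4) in *.
  assert (Hr' : 0 < r) by (unfold r; lra).
  assert (Hq : forall t, Cmod (z + t)%C < r ->
            Cmod (h (z + t) - h z - t * l)%C <= 2 * (M / (r * r)) * Cmod t ^ 2).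
  { intros t Ht.
    assert (S1 := Hs (z + t)%C ltac:(unfold r in *; lra)).
    assert (S2 := Hs z ltac:(unfold r in *; lra)).
    assert (S3 : C_series (fun n => match n with O => RtoC 0
                    | S n => (z ^ n * (INR (S n) * c (S n)))%C end) l).
    { apply is_series_decr_1.
      replace (plus l _) with l; [exact Hl|].
      change (l = (l + - RtoC 0)%C); ring. }
    assert (S4 := C_series_plus _ _ _ _ S1
      (C_series_plus _ _ _ _ (C_series_scal (-1)%R _ _ S2) (C_series_scal (- t)%C _ _ S3))).
    replace (h (z + t) - h z - t * l)%C
      with (h (z + t) + ((-1)%R * h z + - t * l))%C by ring.
    replace (2 * (M / (r * r)) * Cmod t ^ 2)
      with (2 * (M / (r * r) * Cmod t ^ 2)) by ring.
    apply (C_series_geom_le _ _ _ S4).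
    assert (HK : 0 <= M / (r * r) * Cmod t ^ 2).
    { apply Rmult_le_pos; [|apply pow2_ge_0].
      apply Rlt_le, Rdiv_lt_0_compat; nra. }
    intros [|n].
    - replace (_ + _)%C with (RtoC 0) by (simpl; ring).
      rewrite Cmod_0; simpl; lra.
    - replace (_ + _)%C
        with (((z + t) ^ S n - z ^ S n - t * (INR (S n) * z ^ n)) * c (S n))%C
        by ring.
      rewrite Cmod_mult.
      assert (HP := pow_expand_bound z t r n Hr' ltac:(lra) ltac:(lra)).
      set (d := Cmod ((z + t) ^ S n - z ^ S n - t * (INR (S n) * z ^ n))%C) in *.
      assert (Hbn : Cmod (c (S n)) <= M / rho ^ S n).
      { apply Rle_div_r; [now apply pow_lt | apply Hb]. }
      assert (Hd : d <= Cmod t ^ 2 * (2 * r) ^ n * 2 / r) by now apply Rle_div_r.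
      apply Rle_trans with (Cmod t ^ 2 * (2 * r) ^ n * 2 / r * (M / rho ^ S n)).
      + apply Rmult_le_compat; auto; [unfold d|]; apply Cmod_ge_0.
      + right; replace rho with (2 * r * 2) by (unfold r; field).
        change ((2 * r * 2) ^ S n) with (2 * r * 2 * (2 * r * 2) ^ n).
        rewrite (Rpow_mult_distr (2 * r) 2).
        change ((1 / 2) ^ S n) with (1 / 2 * (1 / 2) ^ n).
        replace ((1 / 2) ^ n) with (/ 2 ^ n)
          by (unfold Rdiv; rewrite Rmult_1_l, pow_inv; reflexivity).
        field; repeat split; try lra; apply Rgt_not_eq, pow_lt; lra. }
  set (K := 2 * (M / (r * r))) in *.
  assert (HK : 0 < K) by (apply Rmult_lt_0_compat; [lra | apply Rdiv_lt_0_compat; nra]).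
  split; [apply (is_linear_scal_l (K := C_AbsRing) (V := C_NormedModule))|].
  intros x Hx.
  apply (is_filter_lim_locally_unique (K := C_AbsRing) (V := AbsRing_NormedModule C_AbsRing)) in Hx.
  subst x; intros eps.
  assert (He : 0 < Rmin (r - Cmod z) (eps / K)).
  { apply Rmin_glb_lt; [lra | apply Rdiv_lt_0_compat; [apply cond_pos | exact HK]]. }
  exists (mkposreal _ He); intros y Hy.
  change (Cmod (y - z)%C < Rmin (r - Cmod z) (eps / K)) in Hy.
  change (Cmod (h y - h z - (y - z) * l)%C <= eps * Cmod (y - z)%C).
  assert (Hy1 := Rlt_le_trans _ _ _ Hy (Rmin_l _ _)).
  assert (Hy2 := Rlt_le_trans _ _ _ Hy (Rmin_r _ _)).
  set (t := (y - z)%C) in *.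
  replace y with (z + t)%C by (unfold t; ring).
  eapply Rle_trans; [apply Hq|].
  - eapply Rle_lt_trans; [apply Cmod_triangle | lra].
  - replace (K * Cmod t ^ 2) with (K * Cmod t * Cmod t) by ring.
    apply Rmult_le_compat_r; [apply Cmod_ge_0|].
    apply Rlt_le; rewrite Rmult_comm; now apply Rlt_div_r.
Qed.

(** * The maximum principle *)

Lemma Cmod_le_coords (z : C) : Cmod z <= Rabs (fst z) + Rabs (snd z).
Proof.
  replace z with (RtoC (fst z) + Ci * RtoC (snd z))%C at 1.
  - eapply Rle_trans; [apply Cmod_triangle|].
    rewrite Cmod_mult, Cmod_Ci, !Cmod_R; lra.
  - destruct z as [x y]; unfold RtoC, Ci, Cmult, Cplus; simpl; f_equal; ring.
Qed.

Lemma list_argmax (A : Type) (v : A -> R) (l : list A) :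
  l <> nil -> exists x, In x l /\ forall y, In y l -> v y <= v x.
Proof.
  induction l as [|x l IH]; [easy|]; intros _.
  destruct l as [|y l].
  - exists x; split; [now left | intros y [<-|[]]; lra].
  - destruct IH as [m [Hm Hmax]]; [easy|].
    destruct (Rle_dec (v x) (v m)) as [Hx|Hx].
    + exists m; split; [now right|]; intros w [<-|Hw]; auto.
    + exists x; split; [now left|]; intros w [<-|Hw]; [lra|].
      apply Hmax in Hw; lra.
Qed.

(** Upper semicontinuous functions attain their maximum on a closed disk.  If
    none of its points were a maximum, each would have a neighbourhood on which
    [psi] stays below some value of [psi]; the largest of the finitely many
    values given by a finite subcover would then be strictly below itself. *)
Lemma closed_disk_max (psi : C -> R) (r : R) :
  0 < r ->
  (forall z, Cmod z <= r -> forall eps, 0 < eps ->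
     exists d, 0 < d /\ forall y, Cmod (y - z)%C < d -> psi y < psi z + eps) ->
  exists z0, Cmod z0 <= r /\ forall z, Cmod z <= r -> psi z <= psi z0.
Proof.
  intros Hr Hc.
  apply NNPP; intros Hno.
  assert (Hloc : forall z : C, exists p : posreal * C,
            Cmod (snd p) <= r /\
            forall y, Cmod y <= r -> Cmod (y - z)%C < 2 * fst p -> psi y < psi (snd p)).
  { intros z; destruct (Rle_dec (Cmod z) r) as [Hz|Hz].
    - assert (Hb : exists y, Cmod y <= r /\ psi z < psi y).
      { apply NNPP; intros Hn; apply Hno; exists z; split; [exact Hz|].
        intros y Hy; apply Rnot_lt_le; intros Hl; apply Hn; now exists y. }
      destruct Hb as [y [Hy Hl]].
      destruct (Hc z Hz (psi y - psi z) ltac:(lra)) as [d [Hd H]].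
      assert (Hd2 : 0 < d / 2) by lra.
      exists (mkposreal _ Hd2, y); simpl; split; [exact Hy|].
      intros x _ Hx; assert (Hx' := H x ltac:(lra)); lra.
    - assert (Hd : 0 < (Cmod z - r) / 2) by lra.
      exists (mkposreal _ Hd, RtoC 0); simpl; split; [rewrite Cmod_0; lra|].
      intros y Hy Hyz; exfalso.
      generalize (Cmod_triangle (z - y)%C y).
      replace (z - y + y)%C with z by ring.
      replace (z - y)%C with (- (y - z))%C by ring; rewrite Cmod_opp; lra. }
  set (sel := fun z => proj1_sig (constructive_indefinite_description _ (Hloc z))).
  assert (Hsel : forall z, Cmod (snd (sel z)) <= r /\
            forall y, Cmod y <= r -> Cmod (y - z)%C < 2 * fst (sel z) ->
              psi y < psi (snd (sel z)))
    by (intros z; exact (proj2_sig (constructive_indefinite_description _ (Hloc z)))).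
  set (pt := fun x : Compactness.Tn 2 R => (fst x, fst (snd x)) : C).
  apply (compactness_list 2 (- r, (- r, tt)) (r, (r, tt)) (fun x => fst (sel (pt x)))).
  intros [l Hl].
  assert (Hcov : forall y, Cmod y <= r -> exists t, In t l /\
            psi y < psi (snd (sel (pt t)))).
  { intros y Hy.
    generalize (Rmax_Cmod y) (Rmax_l (Rabs (fst y)) (Rabs (snd y)))
      (Rmax_r (Rabs (fst y)) (Rabs (snd y))); intros H1 H2 H3.
    destruct (Hl (fst y, (snd y, tt))) as [t [Ht [_ Hclose]]].
    - assert (H4 : Rabs (fst y) <= r) by lra.
      assert (H5 : Rabs (snd y) <= r) by lra.
      apply Rabs_le_between in H4; apply Rabs_le_between in H5; simpl; tauto.
    - exists t; split; [exact Ht|].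
      apply Hsel; [exact Hy|].
      destruct t as [t1 [t2 []]]; simpl in Hclose.
      eapply Rle_lt_trans; [apply Cmod_le_coords|].
      change (Rabs (fst y - t1) + Rabs (snd y - t2) < 2 * fst (sel (pt (t1, (t2, tt))))).
      lra. }
  assert (Hne : l <> nil).
  { intros E; destruct (Hcov (RtoC 0)) as [t [Ht _]].
    - rewrite Cmod_0; lra.
    - now rewrite E in Ht. }
  destruct (list_argmax _ (fun t => psi (snd (sel (pt t)))) l Hne) as [t [Ht Hmax]].
  destruct (Hcov (snd (sel (pt t)))) as [t' [Ht' Hlt]]; [apply Hsel|].
  apply Hmax in Ht'; lra.
Qed.

(** Second-order differentiability with a cubic error; on the disk it follows
    from analyticity, and it is all that the maximum principle needs. *)
Definition regular (h : C -> C) (z : C) : Prop :=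
  exists c, jet 3 c (fun t => h (z + t)%C).

Lemma regular_continuous (h : C -> C) (z : C) :
  regular h z -> forall eps, 0 < eps ->
  exists d, 0 < d /\ forall y, Cmod (y - z)%C < d -> Cmod (h y - h z)%C < eps.
Proof.
  intros [c Hj] eps He.
  assert (H0 := jet_head _ _ _ Hj); cbv beta in H0; rewrite Cplus_0_r in H0.
  destruct (jet_small _ _ _ Hj eps He) as [d [Hd H]].
  exists d; split; [exact Hd|]; intros y Hy.
  rewrite H0; replace y with (z + (y - z))%C by ring; auto.
Qed.

(** Averaging over [t, it, -t, -it] kills the terms of order 1 and 2: a
    discrete form of the vanishing of the Laplacian. *)
Lemma regular_four_points (h : C -> C) (z : C) :
  regular h z ->
  exists M d, 0 < M /\ 0 < d /\ forall t : R, 0 < t < d ->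
    Cmod (h (z + t) + h (z + Ci * t) + h (z + - t) + h (z + - (Ci * t))
          - 4 * h z)%C <= M * t ^ 3.
Proof.
  intros [c Hj].
  assert (H0 := jet_head _ _ _ Hj); cbv beta in H0; rewrite Cplus_0_r in H0.
  destruct Hj as [k1 [Hk1 [k2 [Hk2 [k3 [Hk3 [M HM]]]]]]].
  destruct (near0_and _ _ Hk1 (near0_and _ _ Hk2 (near0_and _ _ Hk3 HM)))
    as [d [Hd H]].
  exists (4 * Rmax M 1), d; split; [|split; [exact Hd|]].
  { generalize (Rmax_r M 1); lra. }
  intros t Ht.
  assert (Hm : Cmod (RtoC t) = t) by (rewrite Cmod_R; apply Rabs_pos_eq; lra).
  assert (Hm2 : Cmod (Ci * t)%C = t) by (rewrite Cmod_mult, Cmod_Ci, Hm; ring).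
  assert (Hexp : forall s, Cmod s = t ->
     h (z + s)%C = (c O + s * (c 1%nat + s * (c 2%nat + s * k3 s)))%C /\ Cmod (k3 s) <= Rmax M 1).
  { intros s Hs; destruct (H s) as [E1 [E2 [E3 L]]]; [lra|].
    rewrite E1, E2, E3; split; [reflexivity|].
    eapply Rle_trans; [exact L | apply Rmax_l]. }
  destruct (Hexp (RtoC t) Hm) as [E1 L1].
  destruct (Hexp (Ci * t)%C Hm2) as [E2 L2].
  destruct (Hexp (- RtoC t)%C) as [E3 L3]; [now rewrite Cmod_opp|].
  destruct (Hexp (- (Ci * t))%C) as [E4 L4]; [now rewrite Cmod_opp|].
  rewrite E1, E2, E3, E4, H0.
  assert (HCi : (Ci * Ci)%C = (- (1))%C)
    by (unfold Ci, Cmult, Copp, RtoC; simpl; f_equal; ring).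
  match goal with |- Cmod ?X <= _ =>
    replace X with (t ^ 3 * (k3 t - Ci * k3 (Ci * t) - k3 (- t) + Ci * k3 (- (Ci * t))))%C
  end.
  2:{ set (u1 := k3 _); set (u2 := k3 _); set (u3 := k3 _); set (u4 := k3 _).
      transitivity (t ^ 3 * (u1 + (Ci * Ci) * Ci * u2 - u3 - (Ci * Ci) * Ci * u4)
         + (1 + Ci * Ci) * 2 * t ^ 2 * c 2%nat)%C; [rewrite HCi|]; ring. }
  rewrite Cmod_mult, Cmod_pow, Hm.
  replace (4 * Rmax M 1 * t ^ 3) with (t ^ 3 * (Rmax M 1 + Rmax M 1 + Rmax M 1 + Rmax M 1)) by ring.
  apply Rmult_le_compat_l; [apply pow_le; lra|].
  assert (Hi : forall x, Cmod (Ci * x)%C = Cmod x)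
    by (intros x; rewrite Cmod_mult, Cmod_Ci; ring).
  unfold Cminus.
  eapply Rle_trans; [apply Cmod_triangle|]; rewrite Hi; apply Rplus_le_compat; [|exact L4].
  eapply Rle_trans; [apply Cmod_triangle|]; rewrite Cmod_opp; apply Rplus_le_compat; [|exact L3].
  eapply Rle_trans; [apply Cmod_triangle|]; rewrite Cmod_opp, Hi; apply Rplus_le_compat;
    [exact L1 | exact L2].
Qed.

(** Convexity of the squared modulus: it reduces the average of [|h|^2] over the four
    points to the average of [h]. *)
Lemma Cmod2_tangent (x y : C) :
  Cmod y ^ 2 + 2 * Re (Cconj y * (x - y))%C <= Cmod x ^ 2.
Proof.
  rewrite !Cmod2_alt; destruct x as [a b], y as [c d]; simpl.
  generalize (pow2_ge_0 (a - c)) (pow2_ge_0 (b - d)); simpl; nra.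
Qed.

(** The maximum principle.  Adding [eps |z|^2] to [|h|^2] makes the four-point
    average strictly larger than the central value, so that the maximum over
    the closed disk sits on the boundary circle. *)
Lemma maximum_principle (h : C -> C) (r K : R) :
  0 < r -> 0 <= K ->
  (forall z, Cmod z <= r -> regular h z) ->
  (forall z, Cmod z = r -> Cmod (h z) <= K) ->
  Cmod (h (RtoC 0)) <= K.
Proof.
  intros Hr HK Hreg Hbd.
  assert (Hsq : forall eps, 0 < eps -> Cmod (h (RtoC 0)) ^ 2 <= K ^ 2 + eps * r ^ 2).
  { intros eps He.
    set (psi := fun z : C => Cmod (h z) ^ 2 + eps * Cmod z ^ 2).
    destruct (closed_disk_max psi r Hr) as [z0 [Hz0 Hmax]].
    { intros z Hz e Hpos.
      set (m := Cmod (h z)); set (n := Cmod z).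
      assert (Hm : 0 <= m) by apply Cmod_ge_0.
      assert (Hn : 0 <= n) by apply Cmod_ge_0.
      set (e1 := Rmin 1 (e / (2 * (2 * m + 1)))).
      set (e2 := Rmin 1 (e / (2 * eps * (2 * n + 1)))).
      assert (He1 : 0 < e1) by (apply Rmin_glb_lt; [lra | apply Rdiv_lt_0_compat; lra]).
      assert (He2 : 0 < e2) by (apply Rmin_glb_lt; [lra | apply Rdiv_lt_0_compat; nra]).
      destruct (regular_continuous h z (Hreg z Hz) e1 He1) as [d [Hd H]].
      exists (Rmin d e2); split; [now apply Rmin_glb_lt|]; intros y Hy.
      assert (H1 := H y (Rlt_le_trans _ _ _ Hy (Rmin_l _ _))).
      assert (H2 := Rlt_le_trans _ _ _ Hy (Rmin_r _ _)).
      assert (G1 : Cmod (h y) <= m + Cmod (h y - h z)%C).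
      { unfold m; replace (h y) with (h z + (h y - h z))%C at 1 by ring; apply Cmod_triangle. }
      assert (G2 : Cmod y <= n + Cmod (y - z)%C).
      { unfold n; replace y with (z + (y - z))%C at 1 by ring; apply Cmod_triangle. }
      assert (P1 := Rmin_l 1 (e / (2 * (2 * m + 1)))).
      assert (P2 := Rmin_r 1 (e / (2 * (2 * m + 1)))).
      assert (P3 := Rmin_l 1 (e / (2 * eps * (2 * n + 1)))).
      assert (P4 := Rmin_r 1 (e / (2 * eps * (2 * n + 1)))).
      fold e1 in P1, P2; fold e2 in P3, P4.
      apply Rle_div_r in P2; [|lra].
      apply Rle_div_r in P4; [|nra].
      assert (B1 : Cmod (h y) < m + e1) by lra.
      assert (B2 : Cmod y < n + e2) by lra.
      assert (C1 : Cmod (h y) ^ 2 < (m + e1) ^ 2).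
      { generalize (Cmod_ge_0 (h y)); intros; simpl; nra. }
      assert (C2 : Cmod y ^ 2 < (n + e2) ^ 2).
      { generalize (Cmod_ge_0 y); intros; simpl; nra. }
      assert (D1 : (m + e1) ^ 2 <= m ^ 2 + e / 2) by (simpl; nra).
      assert (D2 : eps * (n + e2) ^ 2 <= eps * n ^ 2 + e / 2).
      { assert (X : (n + e2) ^ 2 <= n ^ 2 + e2 * (2 * n + 1)) by (simpl; nra).
        apply (Rmult_le_compat_l eps) in X; [|lra]. nra. }
      apply (Rmult_lt_compat_l eps) in C2; [|lra].
      unfold psi; fold m n; lra. }
    destruct (Rle_lt_or_eq_dec _ _ Hz0) as [Hin|Heq].
    - exfalso.
      destruct (regular_four_points h z0 (Hreg z0 Hz0)) as [M [d [HM [Hd H4]]]].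
      set (m := Cmod (h z0)); assert (Hm : 0 <= m) by apply Cmod_ge_0.
      set (t := Rmin (d / 2) (Rmin (r - Cmod z0) (eps / (m * M + 1)))).
      assert (Hq : 0 < m * M + 1) by nra.
      assert (Ht : 0 < t).
      { repeat apply Rmin_glb_lt; try lra; now apply Rdiv_lt_0_compat. }
      assert (T1 : t <= d / 2) by apply Rmin_l.
      assert (T2 : t <= r - Cmod z0) by (eapply Rle_trans; [apply Rmin_r | apply Rmin_l]).
      assert (T3 : t <= eps / (m * M + 1)) by (eapply Rle_trans; [apply Rmin_r | apply Rmin_r]).
      apply Rle_div_r in T3; [|exact Hq].
      assert (H := H4 t ltac:(lra)).
      assert (Hmt : Cmod (RtoC t) = t) by (rewrite Cmod_R; apply Rabs_pos_eq; lra).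
      assert (Hmi : Cmod (Ci * t)%C = t) by (rewrite Cmod_mult, Cmod_Ci, Hmt; ring).
      assert (Hpt : forall s, Cmod s = t -> Cmod (z0 + s)%C <= r).
      { intros s Hs; eapply Rle_trans; [apply Cmod_triangle | lra]. }
      assert (M1 := Hmax _ (Hpt (RtoC t) Hmt)).
      assert (M2 := Hmax _ (Hpt (Ci * t)%C Hmi)).
      assert (M3 := Hmax _ (Hpt (- RtoC t)%C ltac:(now rewrite Cmod_opp))).
      assert (M4 := Hmax _ (Hpt (- (Ci * t))%C ltac:(now rewrite Cmod_opp))).
      unfold psi in M1, M2, M3, M4.
      assert (Hz : Cmod (z0 + t)%C ^ 2 + Cmod (z0 + Ci * t)%C ^ 2
                   + Cmod (z0 + - t)%C ^ 2 + Cmod (z0 + - (Ci * t))%C ^ 2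
                   = 4 * Cmod z0 ^ 2 + 4 * t ^ 2).
      { rewrite !Cmod2_alt; destruct z0 as [x y]; simpl; ring. }
      assert (Q1 := Cmod2_tangent (h (z0 + t)%C) (h z0)).
      assert (Q2 := Cmod2_tangent (h (z0 + Ci * t)%C) (h z0)).
      assert (Q3 := Cmod2_tangent (h (z0 + - t)%C) (h z0)).
      assert (Q4 := Cmod2_tangent (h (z0 + - (Ci * t))%C) (h z0)).
      set (S := (h (z0 + t) + h (z0 + Ci * t) + h (z0 + - t) + h (z0 + - (Ci * t))
                 - 4 * h z0)%C) in H.
      assert (HS : Re (Cconj (h z0) * (h (z0 + t) - h z0))%C
                 + Re (Cconj (h z0) * (h (z0 + Ci * t) - h z0))%C
                 + Re (Cconj (h z0) * (h (z0 + - t) - h z0))%C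
                 + Re (Cconj (h z0) * (h (z0 + - (Ci * t)) - h z0))%C
                 = Re (Cconj (h z0) * S)%C).
      { rewrite <- !re_plus; f_equal; unfold S; ring. }
      assert (HR : - (m * (M * t ^ 3)) <= Re (Cconj (h z0) * S)%C).
      { assert (Hx := re_le_Cmod (Cconj (h z0) * S)%C).
        apply Rabs_le_between in Hx.
        rewrite Cmod_mult, Cmod_conj in Hx; fold m in Hx.
        apply (Rmult_le_compat_l m) in H; [lra | exact Hm]. }
      assert (Hfin : m * (M * t ^ 3) < 2 * eps * t ^ 2).
      { replace (m * (M * t ^ 3)) with (m * M * t * t ^ 2) by ring.
        apply Rmult_lt_compat_r; [now apply pow_lt | nra]. }
      fold m in M1, M2, M3, M4, Q1, Q2, Q3, Q4.
      nra.
    - assert (H0 := Hmax (RtoC 0) ltac:(rewrite Cmod_0; lra)).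
      unfold psi in H0; rewrite Cmod_0, Heq in H0.
      assert (Hb := Hbd z0 Heq).
      assert (Cmod (h z0) ^ 2 <= K ^ 2) by (apply pow_incr; split; [apply Cmod_ge_0 | exact Hb]).
      lra. }
  apply Rnot_lt_le; intros Hlt.
  assert (Hd : 0 < Cmod (h (RtoC 0)) ^ 2 - K ^ 2) by (simpl; nra).
  assert (Hr2 : 0 < r ^ 2) by (apply pow_lt; lra).
  assert (Hx := Hsq ((Cmod (h (RtoC 0)) ^ 2 - K ^ 2) / (2 * r ^ 2))
                  ltac:(apply Rdiv_lt_0_compat; lra)).
  replace ((Cmod (h (RtoC 0)) ^ 2 - K ^ 2) / (2 * r ^ 2) * r ^ 2)
    with ((Cmod (h (RtoC 0)) ^ 2 - K ^ 2) / 2) in Hx by (field; lra).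
  lra.
Qed.

(** * Schwarz's lemma and Caratheodory's bound *)

Lemma regular_near (h h' : C -> C) (z : C) :
  near0 (fun t => h (z + t)%C = h' (z + t)%C) -> regular h z -> regular h' z.
Proof. intros He [c Hc]; exists c; now apply (jet_near _ _ _ _ He). Qed.

Lemma regular_plus (h h' : C -> C) (z : C) :
  regular h z -> regular h' z -> regular (fun x => (h x + h' x)%C) z.
Proof. intros [c Hc] [c' Hc']; eexists; exact (jet_plus _ _ _ _ _ Hc Hc'). Qed.

Lemma regular_mult (h h' : C -> C) (z : C) :
  regular h z -> regular h' z -> regular (fun x => (h x * h' x)%C) z.
Proof. intros [c Hc] [c' Hc']; eexists; exact (jet_mult _ _ _ _ _ Hc Hc'). Qed.

Lemma regular_const (x z : C) : regular (fun _ => x) z.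
Proof. eexists; exact (jet_const _ x). Qed.

Lemma regular_id (z : C) : regular (fun x => x) z.
Proof.
  eexists; apply (jet_near _ _ (fun t => z + t * 1)%C).
  - apply near0_true; intros t; ring.
  - exact (jet_plus _ _ _ _ _ (jet_const 3 z) (jet_mul_id 2 _ _ (jet_const 2 (RtoC 1)))).
Qed.

Lemma regular_inv (h : C -> C) (z : C) :
  regular h z -> h z <> RtoC 0 -> regular (fun x => (/ h x)%C) z.
Proof.
  intros [c Hc] Hz; apply (jet_inv 2 c); [exact Hc|].
  assert (H0 := jet_head _ _ _ Hc); cbv beta in H0; rewrite Cplus_0_r in H0.
  now rewrite <- H0.
Qed.

Lemma regular_pow (n : nat) (z : C) : regular (fun x => (x ^ n)%C) z.
Proof.
  induction n as [|n IH]; [apply (regular_const (RtoC 1))|].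
  apply (regular_mult (fun x => x)); [apply regular_id | exact IH].
Qed.

Lemma regular_rotate (h : C -> C) (x z : C) :
  regular h (x * z)%C -> regular (fun y => h (x * y)%C) z.
Proof.
  intros [c Hc]; exists (fun i => (c i * x ^ i)%C).
  apply (jet_near _ _ (fun t => h (x * z + x * t)%C)).
  - apply near0_true; intros t; f_equal; ring.
  - now apply (jet_rescale 3 x c (fun t => h (x * z + t)%C)).
Qed.

Lemma regular_of_jet (c : nat -> C) (h : C -> C) :
  jet 3 c h -> regular h (RtoC 0).
Proof.
  intros H; exists c; revert H; apply jet_near, near0_true.
  intros t; f_equal; ring.
Qed.

Lemma regular_of_analytic (h : C -> C) (z : C) :
  analytic_on_disk h -> in_disk z -> regular h z.
Proof.
  intros Ha Hz; destruct (near_pseries_of_analytic h z Ha Hz) as [c Hc].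
  exists c; now apply near_pseries_jet.
Qed.

Lemma jet_factor (n N : nat) (c : nat -> C) (h : C -> C) :
  jet (n + N) c h -> (forall i, (i < n)%nat -> c i = RtoC 0) ->
  exists k, jet N (fun i => c (n + i)%nat) k /\
            near0 (fun t => h t = (t ^ n * k t)%C).
Proof.
  revert c h; induction n as [|n IH]; intros c h Hj Hc.
  - exists h; split; [exact Hj | apply near0_true; intros t; simpl; ring].
  - destruct Hj as [k1 [Hk1 Jk1]].
    destruct (IH _ _ Jk1) as [k [Jk Hk]]; [intros i Hi; apply Hc; lia|].
    exists k; split; [exact Jk|].
    generalize (near0_and _ _ Hk1 Hk); apply near0_imp; intros t [E1 E].
    rewrite E1, E, Hc; [simpl; ring | lia].
Qed.

(** Schwarz's lemma for a zero of order [n]: the maximum principle bounds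
    [W / z^n] at the origin by [1 / r^n] for each [r < 1]. *)
Lemma schwarz_order (n : nat) (W H : C -> C) :
  (forall z, in_disk z -> z <> RtoC 0 -> regular W z) ->
  (forall z, in_disk z -> Cmod (W z) <= 1) ->
  regular H (RtoC 0) -> near0 (fun t => W t = (t ^ n * H t)%C) ->
  Cmod (H (RtoC 0)) <= 1.
Proof.
  intros HW Hb HH Hn.
  set (h := fun z => if Ceq_dec z (RtoC 0) then H (RtoC 0) else (W z * / z ^ n)%C).
  assert (Hr : forall r, 0 < r < 1 -> Cmod (H (RtoC 0)) <= / r ^ n).
  { intros r Hr.
    assert (Hrn : 0 < r ^ n) by (apply pow_lt; lra).
    replace (H (RtoC 0)) with (h (RtoC 0))
      by (unfold h; now destruct (Ceq_dec (RtoC 0) (RtoC 0))).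
    apply (maximum_principle h r); [lra | now apply Rlt_le, Rinv_0_lt_compat | |].
    - intros z Hz.
      destruct (Ceq_dec z (RtoC 0)) as [->|Hz0].
      + apply (regular_near H); [|exact HH].
        revert Hn; apply near0_imp; intros t E.
        rewrite Cplus_0_l; unfold h; destruct (Ceq_dec t (RtoC 0)) as [->|Ht]; [reflexivity|].
        rewrite E; field; now apply Cpow_nz.
      + apply (regular_near (fun x => (W x * / x ^ n)%C)).
        * exists (Cmod z); split; [now apply Cmod_gt_0|]; intros t Ht.
          unfold h; destruct (Ceq_dec (z + t)%C (RtoC 0)) as [E|_]; [|reflexivity].
          exfalso; replace z with (- t)%C in Ht.
          -- rewrite Cmod_opp in Ht; lra.
          -- replace z with (z + t - t)%C by ring; rewrite E; ring.
        * apply regular_mult; [apply HW; [unfold in_disk; lra | exact Hz0]|].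
          apply regular_inv; [apply regular_pow | now apply Cpow_nz].
    - intros z Hz.
      assert (Hz0 : z <> RtoC 0) by (apply Cmod_gt_0; lra).
      unfold h; destruct (Ceq_dec z (RtoC 0)) as [E|_]; [easy|].
      rewrite Cmod_mult, Cmod_inv, Cmod_pow, Hz by now apply Cpow_nz.
      rewrite <- (Rmult_1_l (/ r ^ n)) at 2.
      apply Rmult_le_compat_r; [now apply Rlt_le, Rinv_0_lt_compat|].
      apply Hb; unfold in_disk; lra. }
  apply Rnot_lt_le; intros Hlt.
  set (A := Cmod (H (RtoC 0))) in *.
  (* small enough that Bernoulli's inequality (1 - e)^n >= 1 - n e contradicts
     A (1 - e)^n <= 1 *)
  set (e := (A - 1) / (2 * A * (INR n + 1))).
  assert (Hn0 := pos_INR n).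
  assert (He : 0 < e) by (apply Rdiv_lt_0_compat; nra).
  assert (He' : e * (2 * A * (INR n + 1)) = A - 1) by (unfold e; field; split; lra).
  clearbody e.
  assert (HAn : 0 <= A * INR n) by nra.
  assert (HAe : 0 <= e * (A * INR n)) by nra.
  assert (He1 : e < 1) by nra.
  assert (Hbern : 1 - INR n * e <= (1 - e) ^ n).
  { clear - He He1; induction n as [|n IH]; [simpl; lra|].
    rewrite S_INR; simpl.
    apply Rle_trans with ((1 - e) * (1 - INR n * e)); [generalize (Rmult_le_pos _ _ (pos_INR n) (pow2_ge_0 e)); nra|].
    apply Rmult_le_compat_l; lra. }
  assert (Hp : 0 < (1 - e) ^ n) by (apply pow_lt; lra).
  assert (H1 := Hr (1 - e) ltac:(lra)).
  apply (Rmult_le_compat_r ((1 - e) ^ n)) in H1; [|lra].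
  rewrite Rinv_l in H1; [|lra].
  apply (Rmult_le_compat_l A) in Hbern; [|lra].
  nra.
Qed.

Definition C_sum (u : nat -> C) (m : nat) : C := sum_n (G := C_AbelianMonoid) u m.

Lemma C_sum_S (u : nat -> C) (m : nat) : C_sum u (S m) = (C_sum u m + u (S m))%C.
Proof. exact (sum_Sn (G := C_AbelianMonoid) u m). Qed.

Lemma C_sum_O (u : nat -> C) : C_sum u 0 = u O.
Proof. exact (sum_O (G := C_AbelianMonoid) u). Qed.

Lemma C_sum_geom (x : C) (m : nat) :
  ((1 - x) * C_sum (fun j => x ^ j) m)%C = (1 - x ^ S m)%C.
Proof.
  induction m as [|m IH]; [rewrite C_sum_O; simpl; ring|].
  rewrite C_sum_S, Cmult_plus_distr_l, IH; simpl; ring.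
Qed.

Lemma C_sum_scal (x : C) (u : nat -> C) (m : nat) :
  C_sum (fun j => x * u j)%C m = (x * C_sum u m)%C.
Proof.
  induction m as [|m IH]; [now rewrite !C_sum_O|].
  rewrite !C_sum_S, IH; ring.
Qed.

Lemma C_sum_one (m : nat) : C_sum (fun _ => RtoC 1) m = RtoC (INR (S m)).
Proof.
  induction m as [|m IH]; [now rewrite C_sum_O|].
  rewrite C_sum_S, IH, (S_INR (S m)), RtoC_plus; reflexivity.
Qed.

Lemma C_sum_ext (u v : nat -> C) (m : nat) :
  (forall j, u j = v j) -> C_sum u m = C_sum v m.
Proof. apply (sum_n_ext (G := C_AbelianMonoid)). Qed.

Lemma jet_sum (N : nat) (c : nat -> nat -> C) (h : nat -> C -> C) (m : nat) :
  (forall j, jet N (c j) (h j)) ->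
  jet N (fun i => C_sum (fun j => c j i) m) (fun t => C_sum (fun j => h j t) m).
Proof.
  intros H; induction m as [|m IH].
  - apply (jet_ext _ (c O) _ (h O)); [| |apply H].
    + intros i _; now rewrite C_sum_O.
    + apply near0_true; intros t; now rewrite C_sum_O.
  - eapply jet_ext; [| |exact (jet_plus _ _ _ _ _ IH (H (S m)))].
    + intros i _; now rewrite C_sum_S.
    + apply near0_true; intros t; now rewrite C_sum_S.
Qed.

Lemma regular_sum (h : nat -> C -> C) (z : C) (m : nat) :
  (forall j, regular (h j) z) -> regular (fun x => C_sum (fun j => h j x) m) z.
Proof.
  intros H; induction m as [|m IH].
  - apply (regular_near (h O)); [|apply H].
    apply near0_true; intros t; now rewrite C_sum_O.
  - apply (regular_near (fun x => (C_sum (fun j => h j x) m + h (S m) x)%C)).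
    + apply near0_true; intros t; now rewrite C_sum_S.
    + now apply regular_plus.
Qed.

Lemma C_sum_Re_gt (u : nat -> C) (x : R) (m : nat) :
  (forall j, x < Re (u j)) -> INR (S m) * x < Re (C_sum u m).
Proof.
  intros H; induction m as [|m IH].
  - rewrite C_sum_O; simpl; rewrite Rmult_1_l; apply H.
  - rewrite C_sum_S, re_plus, (S_INR (S m)); generalize (H (S m)); lra.
Qed.

(** Caratheodory's coefficient bound for [1 + 2 q], a function of positive real
    part.  Averaging [q] over the rotations by the [n]-th roots of unity,
    [n = m + 1], keeps [Re q > -1/2] and leaves [c_n z^n + ...]; the Moebius map
    [Q / (1 + Q)] of the average into the unit disk then has a zero of order
    [n] with leading coefficient [c_n]. *)
Lemma caratheodory_bound (q : C -> C) (c : nat -> C) (zeta : C) (m : nat) :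
  (forall z, in_disk z -> regular q z) ->
  (forall z, in_disk z -> - (1 / 2) < Re (q z)) ->
  jet (S m + 3) c q -> c O = RtoC 0 ->
  Cmod zeta = 1 -> (zeta ^ S m)%C = RtoC 1 ->
  (forall k, (0 < k <= m)%nat -> (zeta ^ k)%C <> RtoC 1) ->
  Cmod (c (S m)) <= 1.
Proof.
  intros Hreg Hre Hjet Hc0 Hz1 Hroot Hprim.
  set (Q := fun z => (/ INR (S m) * C_sum (fun j => q (zeta ^ j * z)) m)%C).
  assert (Hm : 0 < INR (S m)) by (apply lt_0_INR; lia).
  assert (HmC : RtoC (INR (S m)) <> RtoC 0) by (intros E; apply RtoC_inj in E; lra).
  assert (Hdisk : forall j z, in_disk z -> in_disk (zeta ^ j * z)%C).
  { intros j z Hz; unfold in_disk; rewrite Cmod_mult, Cmod_pow, Hz1, pow1; unfold in_disk in Hz; lra. }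
  assert (HQreg : forall z, in_disk z -> regular Q z).
  { intros z Hz; apply regular_mult; [apply (regular_const (/ INR (S m))%C)|].
    apply (regular_sum (fun j x => q (zeta ^ j * x)%C)); intros j.
    apply (regular_rotate q); auto. }
  assert (HQre : forall z, in_disk z -> - (1 / 2) < Re (Q z)).
  { intros z Hz; unfold Q; rewrite <- RtoC_inv by lra.
    rewrite re_scal_l.
    assert (Hs := C_sum_Re_gt (fun j => q (zeta ^ j * z)%C) (- (1 / 2)) m
                    ltac:(intros j; apply Hre; auto)).
    apply (Rmult_lt_compat_l (/ INR (S m))) in Hs; [|now apply Rinv_0_lt_compat].
    rewrite <- Rmult_assoc, Rinv_l in Hs; lra. }
  assert (HQ1 : forall z, in_disk z -> (1 + Q z)%C <> RtoC 0).
  { intros z Hz E; generalize (HQre z Hz) (f_equal Re E).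
    rewrite re_plus, !re_RtoC; lra. }
  set (e := fun i => (/ INR (S m) * C_sum (fun j => c i * (zeta ^ j) ^ i) m)%C).
  assert (HQjet : jet (S m + 3) e Q).
  { apply jet_scal.
    apply (jet_sum _ (fun j i => (c i * (zeta ^ j) ^ i)%C) (fun j t => q (zeta ^ j * t)%C)).
    intros j; now apply jet_rescale. }
  assert (Hpow : forall i j, ((zeta ^ j) ^ i)%C = ((zeta ^ i) ^ j)%C).
  { intros i j; now rewrite <- !Cpow_mult_r, Nat.mul_comm. }
  assert (He : forall i, (i < S m)%nat -> e i = RtoC 0).
  { intros i Hi; unfold e; rewrite C_sum_scal.
    destruct i as [|i]; [rewrite Hc0; ring|].
    rewrite (C_sum_ext _ (fun j => (zeta ^ S i) ^ j)%C) by (intros j; apply Hpow).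
    assert (G := C_sum_geom (zeta ^ S i)%C m).
    rewrite <- (Hpow (S i) (S m)), Hroot, Cpow_1_l in G.
    assert (Hne : (1 - zeta ^ S i)%C <> RtoC 0).
    { intros E; apply (Hprim (S i)); [lia|].
      symmetry; apply Ceq_minus; exact E. }
    replace (C_sum (fun j => ((zeta ^ S i) ^ j)%C) m) with (RtoC 0); [ring|].
    replace (C_sum (fun j => ((zeta ^ S i) ^ j)%C) m)
      with (/ (1 - zeta ^ S i) * ((1 - zeta ^ S i) * C_sum (fun j => (zeta ^ S i) ^ j) m))%C
      by (field; exact Hne).
    rewrite G; field; exact Hne. }
  assert (Hen : e (S m) = c (S m)).
  { unfold e; rewrite C_sum_scal.
    rewrite (C_sum_ext _ (fun _ => RtoC 1)).
    - rewrite C_sum_one; field; exact HmC.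
    - intros j; rewrite Hpow, Hroot; apply Cpow_1_l. }
  destruct (jet_factor (S m) 3 e Q HQjet He) as [k [Jk Hk]].
  assert (Hk0 := jet_head _ _ _ Jk); cbv beta in Hk0; rewrite Nat.add_0_r, Hen in Hk0.
  assert (HQ0 : Q (RtoC 0) = RtoC 0).
  { rewrite (jet_head (m + 3) _ _ HQjet); apply He; lia. }
  assert (H0d : in_disk (RtoC 0)) by (unfold in_disk; rewrite Cmod_0; lra).
  assert (Hinv : forall z, in_disk z -> regular (fun x => / (1 + Q x))%C z).
  { intros z Hz; apply regular_inv; auto.
    apply regular_plus; [apply regular_const | auto]. }
  assert (HS := schwarz_order (S m) (fun z => Q z * / (1 + Q z))%C
                  (fun z => k z * / (1 + Q z))%C).
  cbv beta in HS; rewrite HQ0, Hk0 in HS.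
  replace (c (S m)) with (c (S m) * / (1 + 0))%C by (field; intros E; apply RtoC_inj in E; lra).
  apply HS; clear HS.
  - intros z Hz _; apply regular_mult; auto.
  - intros z Hz; rewrite Cmod_mult, Cmod_inv; auto.
    assert (Hp : 0 < Cmod (1 + Q z)%C) by (apply Cmod_gt_0; auto).
    apply Rle_div_l; [exact Hp|]; rewrite Rmult_1_l.
    apply Rsqr_incr_0; auto using Cmod_ge_0.
    rewrite !Rsqr_pow2, !Cmod2_alt.
    generalize (HQre z Hz); destruct (Q z) as [x y]; simpl; nra.
  - apply regular_mult; auto. now apply regular_of_jet in Jk.
  - revert Hk; apply near0_imp; intros t ->; ring.
Qed.

(** For a Schwarz function [w], the three bounded quantities are the coefficients
    of [q = w / (1 - w)], read off from [q = w + q w]; [1 + 2 q] is the half-plane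
    function [(1 + w) / (1 - w)]. *)
Lemma schwarz_coefficients (w : C -> C) :
  analytic_on_disk w -> w (RtoC 0) = RtoC 0 ->
  (forall z, in_disk z -> Cmod (w z) < 1) ->
  exists c : nat -> C,
    (forall N, jet N c w) /\ c O = RtoC 0 /\
    Cmod (c 1%nat) <= 1 /\
    Cmod (c 2%nat + c 1%nat ^ 2)%C <= 1 /\
    Cmod (c 3%nat + 2 * c 1%nat * c 2%nat + c 1%nat ^ 3)%C <= 1.
Proof.
  intros Ha Hw0 Hw.
  assert (H0d : in_disk (RtoC 0)) by (unfold in_disk; rewrite Cmod_0; lra).
  destruct (near_pseries_of_analytic_0 w Ha) as [c Hnear].
  assert (Hj : forall N, jet N c w) by (intros N; now apply near_pseries_jet).
  assert (Hc0 : c O = RtoC 0) by (now rewrite <- (jet_head _ _ _ (Hj 1%nat))).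
  set (q := fun z => (w z * / (1 + - (1) * w z))%C).
  assert (Hden : forall z, in_disk z -> (1 + - (1) * w z)%C <> RtoC 0).
  { intros z Hz E; generalize (Hw z Hz).
    replace (w z) with (RtoC 1); [rewrite Cmod_1; lra|].
    apply Ceq_minus; rewrite <- E; ring. }
  assert (Hqreg : forall z, in_disk z -> regular q z).
  { intros z Hz; assert (Hwr := regular_of_analytic w z Ha Hz).
    apply regular_mult; [exact Hwr|]; apply regular_inv; [|auto].
    apply regular_plus; [apply (regular_const (RtoC 1))|].
    apply regular_mult; [apply regular_const | exact Hwr]. }
  assert (Hqre : forall z, in_disk z -> - (1 / 2) < Re (q z)).
  { intros z Hz; assert (Hz1 := Hden z Hz).
    assert (Hp : 0 < Cmod (1 + - (1) * w z)%C ^ 2) by (apply pow_lt, Cmod_gt_0; auto).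
    assert (Hl : Cmod (w z) ^ 2 < 1).
    { generalize (Hw z Hz) (Cmod_ge_0 (w z)); simpl; nra. }
    unfold q; rewrite Cmod2_alt in Hp, Hl; destruct (w z) as [x y].
    simpl in Hp, Hl.
    replace (Re ((x, y) * / (1 + - (1) * (x, y)))%C)
      with (- (1 / 2) + (1 - (x * x + y * y)) / (2 * ((1 - x) * (1 - x) + y * y))).
    - assert (0 < (1 - (x * x + y * y)) / (2 * ((1 - x) * (1 - x) + y * y)))
        by (apply Rdiv_lt_0_compat; nra).
      lra.
    - simpl; field; nra. }
  (* order 6 = 3 + 3: the bound on the third coefficient needs a regular cofactor
     of z^3 *)
  destruct (jet_inv 5 (fun i => const_seq (RtoC 1) i + - (1) * c i)%C
              (fun z => 1 + - (1) * w z)%C) as [e He].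
  { apply jet_plus; [apply jet_const | apply jet_scal, Hj]. }
  { simpl; rewrite Hc0; intros E; apply (f_equal Re) in E; simpl in E; lra. }
  set (d := cauchy_mul c e).
  assert (Hd : jet 6 d q) by (apply jet_mult; [apply Hj | exact He]).
  assert (Hrec : forall i, (i < 6)%nat -> d i = (c i + cauchy_mul d c i)%C).
  { apply (jet_unique _ _ _ q (fun z => w z + q z * w z)%C Hd).
    - apply jet_plus; [apply Hj | apply jet_mult; [exact Hd | apply Hj]].
    - exists 1; split; [lra|]; intros z Hz _; unfold q.
      assert (Hne := Hden z Hz); set (D := (1 + - (1) * w z)%C) in *.
      transitivity (w z * (D + w z) * / D)%C;
        [unfold D; f_equal; ring | field; exact Hne]. }
  assert (D0 : d O = RtoC 0).
  { rewrite (Hrec O) by lia; simpl; rewrite Hc0; ring. }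
  assert (D1 : d 1%nat = c 1%nat).
  { rewrite (Hrec 1%nat) by lia; simpl; rewrite D0, Hc0; ring. }
  assert (D2 : d 2%nat = (c 2%nat + c 1%nat ^ 2)%C).
  { rewrite (Hrec 2%nat) by lia; simpl; rewrite D0, D1, Hc0; ring. }
  assert (D3 : d 3%nat = (c 3%nat + 2 * c 1%nat * c 2%nat + c 1%nat ^ 3)%C).
  { rewrite (Hrec 3%nat) by lia; simpl; rewrite D0, D1, D2, Hc0; ring. }
  exists c; split; [exact Hj|]; split; [exact Hc0|].
  rewrite <- D1 at 1; rewrite <- D2, <- D3; repeat split.
  - apply (caratheodory_bound q d (RtoC 1) 0); auto.
    + apply jet_lower with 6%nat; [lia | exact Hd].
    + apply Cmod_1.
    + simpl; ring.
    + intros k Hk; lia.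
  - apply (caratheodory_bound q d (- (1))%C 1); auto.
    + apply jet_lower with 6%nat; [lia | exact Hd].
    + apply Cmod_m1.
    + simpl; ring.
    + intros k Hk; replace k with 1%nat by lia.
      intros E; apply (f_equal Re) in E; simpl in E; lra.
  - assert (H3 : sqrt 3 * sqrt 3 = 3) by (apply sqrt_sqrt; lra).
    assert (Hy : sqrt 3 / 2 * (sqrt 3 / 2) = 3 / 4) by nra.
    (* a primitive cube root of unity *)
    set (y := sqrt 3 / 2) in *.
    set (zeta := (- (1 / 2), y) : C).
    assert (Hsq : (zeta * zeta)%C = (- (1 / 2), - y))
      by (unfold zeta, Cmult; simpl; f_equal; nra).
    apply (caratheodory_bound q d zeta 2); auto.
    + apply Rsqr_inj; [apply Cmod_ge_0 | lra |].
      rewrite !Rsqr_pow2, Cmod2_alt; simpl; nra.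
    + simpl; rewrite Cmult_1_r, Hsq.
      unfold zeta, Cmult, RtoC; simpl; f_equal; nra.
    + intros k Hk E; assert (k = 1 \/ k = 2)%nat as [-> | ->] by lia; simpl in E.
      * apply (f_equal Re) in E; simpl in E; lra.
      * rewrite Cmult_1_r, Hsq in E; apply (f_equal Re) in E; simpl in E; lra.
Qed.

(** * Coefficient relations *)

(** What membership in the class says about the first coefficients.  For the
    Schwarz function [w] of the subordination, [P1], [P2], [P3] are half the
    coefficients of [(1 + w) / (1 - w)], so that [phi (w z)] expands as
    [1 + B1 P1 z + (B1 P2 + (B2 - B1) P1^2) z^2 + ...]. *)
Definition M_relations (lam B1 : R) (B2 B3 a2 a3 a4 P1 P2 P3 : C) : Prop :=
  (Cmod P1 <= 1 /\ Cmod P2 <= 1 /\ Cmod P3 <= 1) /\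
  ((1 + lam) * a2 = B1 * P1)%C /\
  (2 * (1 + 2 * lam) * a3 - (1 + 3 * lam) * a2 ^ 2 = B1 * P2 + (B2 - B1) * P1 ^ 2)%C /\
  (3 * (1 + 3 * lam) * a4 - 3 * (1 + 5 * lam) * a2 * a3 + (1 + 7 * lam) * a2 ^ 3
   = B1 * P3 + 2 * (B2 - B1) * P1 * P2 + (B1 - 2 * B2 + B3) * P1 ^ 3)%C.

(** Clearing the denominators of the two quotients leaves only sums, products and
    the composition [phi o w] of expansions to compare. *)
Lemma class_M_relations (lam B1 : R) (phi f : C -> C) (B a : nat -> C) :
  taylor_on_disk phi B -> B O = RtoC 1 -> B 1%nat = RtoC B1 ->
  near_pseries a f -> a O = RtoC 0 -> a 1%nat = RtoC 1 ->
  class_M lam phi f ->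
  exists P1 P2 P3 : C,
    M_relations lam B1 (B 2%nat) (B 3%nat) (a 2%nat) (a 3%nat) (a 4%nat) P1 P2 P3.
Proof.
  intros Hphi HB0 HB1 Hf Ha0 Ha1 [_ [Hnz [w [Hwa [Hw0 [Hwb Heq]]]]]].
  destruct (schwarz_coefficients w Hwa Hw0 Hwb) as [c [Hc [Hc0 [Hc1 [Hc2 Hc3]]]]].
  destruct (near_pseries_jet 5 a f Hf) as [k [Hk Jk]].
  change (jet 4 (fun i => a (S i)) k) in Jk.
  assert (Hf1 := near_pseries_derive _ _ Hf).
  assert (Hf2 := near_pseries_derive _ _ Hf1).
  assert (J1 := near_pseries_jet 4 _ _ Hf1).
  assert (J2 := near_pseries_jet 3 _ _ Hf2).
  assert (JB := jet_comp 4 B c phi w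
     (near_pseries_jet 4 _ _ (near_pseries_of_taylor _ _ Hphi)) (Hc 5%nat) Hc0).
  (* both sides multiplied by f' f / z, where k is f / z *)
  assert (JL := jet_plus _ _ _ _ _
     (jet_scal _ lam _ _ (jet_mult _ _ _ _ _ (jet_plus _ _ _ _ _ J1 (jet_mul_id _ _ _ J2)) Jk))
     (jet_scal _ (1 - lam)%C _ _ (jet_mult _ _ _ _ _ J1 J1))).
  assert (JR := jet_mult _ _ _ _ _ JB (jet_mult _ _ _ _ _ J1 Jk)).
  assert (Hcoef := jet_unique _ _ _ _ _ JL JR); cbv beta in Hcoef.
  match type of Hcoef with ?X -> _ => assert (Hpt : X) end.
  { clear Hcoef.
    destruct Hk as [d [Hd Hk]].
    exists (Rmin d 1); split; [apply Rmin_glb_lt; lra|]; intros z Hz Hz0.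
    assert (Hzd : in_disk z) by (eapply Rlt_le_trans; [exact Hz | apply Rmin_r]).
    assert (Ek := Hk z (Rlt_le_trans _ _ _ Hz (Rmin_l _ _))).
    rewrite Ha0, Cplus_0_l in Ek.
    destruct (Hnz z Hzd) as [N1 N2]; specialize (N2 Hz0).
    rewrite <- (Heq z Hzd).
    unfold convex_quotient, starlike_quotient.
    destruct (Ceq_dec z (RtoC 0)) as [E|_]; [easy|].
    rewrite Ek in N2 |- *.
    assert (N3 : k z <> RtoC 0) by (intros E; apply N2; rewrite E; ring).
    field; auto. }
  specialize (Hcoef Hpt).
  assert (E1 := Hcoef 1%nat ltac:(lia)).
  assert (E2 := Hcoef 2%nat ltac:(lia)).
  assert (E3 := Hcoef 3%nat ltac:(lia)).
  clear - E1 E2 E3 HB0 HB1 Ha0 Ha1 Hc0 Hc1 Hc2 Hc3.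
  set (P1 := c 1%nat); set (P2 := (c 2%nat + c 1%nat ^ 2)%C).
  set (P3 := (c 3%nat + 2 * c 1%nat * c 2%nat + c 1%nat ^ 3)%C).
  cbn [cauchy_mul compose_seq] in E1, E2, E3.
  replace (INR 1) with 1 in * by reflexivity.
  replace (INR 2) with 2 in * by (simpl; ring).
  replace (INR 3) with 3 in * by (simpl; ring).
  replace (INR 4) with 4 in * by (simpl; ring).
  rewrite HB0, HB1, Ha1, ?Ha0, ?Hc0 in E1, E2, E3.
  assert (T1 : ((1 + lam) * a 2%nat - B1 * P1)%C = 0%C).
  { apply Ceq_minus in E1.
    match type of E1 with ?X = _ => transitivity X; [unfold P1; ring | exact E1] end. }
  assert (T2 : (2 * (1 + 2 * lam) * a 3%nat - (1 + 3 * lam) * a 2%nat ^ 2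
     - (B1 * P2 + (B 2%nat - B1) * P1 ^ 2))%C = 0%C).
  { apply Ceq_minus in E2.
    match type of E2 with ?X = _ => match type of T1 with ?Y = _ =>
      transitivity (X - 3 * a 2%nat * Y)%C;
      [unfold P2, P1; ring | rewrite E2, T1; ring] end end. }
  exists P1, P2, P3; repeat split; auto; apply Ceq_minus; auto.
  apply Ceq_minus in E3.
  match type of E3 with ?X = _ => match type of T2 with ?Y = _ =>
    match type of T1 with ?Z = _ =>
      transitivity (X - 3 * a 2%nat * Y - (4 * a 3%nat + 2 * a 2%nat ^ 2) * Z)%C;
      [unfold P3, P2, P1; ring | rewrite E3, T2, T1; ring] end end end.
Qed.

Lemma inverse_coefficients (f g : C -> C) (a b : nat -> C) :
  near_pseries a f -> near_pseries b g ->
  a O = RtoC 0 -> a 1%nat = RtoC 1 -> b O = RtoC 0 ->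
  near0 (fun t => f (g t) = t) ->
  b 1%nat = RtoC 1 /\ b 2%nat = (- a 2%nat)%C /\
  b 3%nat = (2 * a 2%nat ^ 2 - a 3%nat)%C /\
  b 4%nat = (- (5) * a 2%nat ^ 3 + 5 * a 2%nat * a 3%nat - a 4%nat)%C.
Proof.
  intros Hf Hg Ha0 Ha1 Hb0 Hfg.
  assert (J := jet_comp 5 a b f g (near_pseries_jet 5 _ _ Hf)
                 (near_pseries_jet 6 _ _ Hg) Hb0).
  assert (Ji := jet_mul_id 4 _ _ (jet_const 4 (RtoC 1))).
  assert (Hcoef := jet_unique _ _ _ _ _ J Ji).
  match type of Hcoef with ?X -> _ => assert (Hpt : X) end.
  { revert Hfg; apply near0_imp; intros t E _; rewrite E; ring. }
  specialize (Hcoef Hpt).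
  assert (E1 := Hcoef 1%nat ltac:(lia)).
  assert (E2 := Hcoef 2%nat ltac:(lia)).
  assert (E3 := Hcoef 3%nat ltac:(lia)).
  assert (E4 := Hcoef 4%nat ltac:(lia)).
  clear - E1 E2 E3 E4 Ha0 Ha1 Hb0.
  cbn [cauchy_mul compose_seq const_seq] in E1, E2, E3, E4.
  rewrite Ha1 in E1, E2, E3, E4.
  assert (F1 : b 1%nat = RtoC 1) by (rewrite <- E1; ring).
  rewrite F1 in E2, E3, E4.
  assert (F2 : b 2%nat = (- a 2%nat)%C).
  { apply Ceq_minus; rewrite <- E2; ring. }
  rewrite F2 in E3, E4.
  assert (F3 : b 3%nat = (2 * a 2%nat ^ 2 - a 3%nat)%C).
  { apply Ceq_minus; rewrite <- E3; ring. }
  rewrite F3 in E4.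
  repeat split; auto.
  apply Ceq_minus; rewrite <- E4; ring.
Qed.

(** * Elimination and bounds *)

(** The sum and the difference of the second-order relations of [f] and of its
    inverse give [P1^2] and [a3 - a2^2]; in the sum of the third-order ones [a4]
    cancels, which ties [P1 (P2 - Q2)] to [P3 + Q3]. *)
Lemma bi_relations (lam B1 : R) (B2 B3 a2 a3 a4 P1 P2 P3 Q1 Q2 Q3 : C) :
  0 < B1 ->
  M_relations lam B1 B2 B3 a2 a3 a4 P1 P2 P3 ->
  M_relations lam B1 B2 B3 (- a2)%C (2 * a2 ^ 2 - a3)%C
    (- (5) * a2 ^ 3 + 5 * a2 * a3 - a4)%C Q1 Q2 Q3 ->
  Q1 = (- P1)%C /\
  (4 * (1 + 2 * lam) * (a3 - a2 ^ 2) = B1 * (P2 - Q2))%C /\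
  (2 * (B1 ^ 2 + (1 + lam) * (B1 - B2)) * P1 ^ 2 = (1 + lam) * B1 * (P2 + Q2))%C /\
  (P1 * (P2 - Q2) * ((9 + 15 * lam) * B1 ^ 2 - 8 * (1 + 2 * lam) * (1 + lam) * (B2 - B1))
   = 4 * (1 + lam) * (1 + 2 * lam) * B1 * (P3 + Q3))%C.
Proof.
  intros HB [_ [E1 [E2 E3]]] [_ [F1 [F2 F3]]].
  assert (HB' : RtoC B1 <> RtoC 0) by (intros E; apply RtoC_inj in E; lra).
  assert (HQ : Q1 = (- P1)%C).
  { replace Q1 with (/ B1 * (B1 * Q1))%C by (field; exact HB').
    rewrite <- F1.
    transitivity (- (/ B1 * ((1 + lam) * a2)))%C; [ring|].
    rewrite E1; field; exact HB'. }
  subst Q1.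
  assert (I3 : (4 * (1 + 2 * lam) * (a3 - a2 ^ 2) = B1 * (P2 - Q2))%C).
  { apply Ceq_minus; apply Ceq_minus in E2, F2.
    match type of E2 with ?X = _ => match type of F2 with ?Y = _ =>
      transitivity (X - Y)%C; [ring | rewrite E2, F2; ring] end end. }
  split; [reflexivity|]; split; [exact I3|]; split.
  - apply Ceq_minus; apply Ceq_minus in E1, E2, F2.
    match type of E1 with ?Z = _ => match type of E2 with ?X = _ => match type of F2 with ?Y = _ =>
      transitivity ((1 + lam) * (X + Y) - 2 * Z * ((1 + lam) * a2 + B1 * P1))%C;
      [ring | rewrite E1, E2, F2; ring] end end end.
  - apply Ceq_minus; apply Ceq_minus in E1, I3, E3, F3.
    match type of E1 with ?Z = _ => match type of E3 with ?X = _ => match type of F3 with ?Y = _ =>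
    match type of I3 with ?T = _ =>
      transitivity (4 * (1 + lam) * (1 + 2 * lam) * (X + Y)
                    - (9 + 15 * lam) * (1 + lam) * a2 * T
                    - (9 + 15 * lam) * B1 * (P2 - Q2) * Z)%C;
      [ring | rewrite E1, E3, F3, I3; ring] end end end end.
Qed.

Lemma RtoC_neq_0 (x : R) : x <> 0 -> RtoC x <> RtoC 0.
Proof. intros Hx E; apply RtoC_inj in E; auto. Qed.

Lemma Cmod_nonneg_R (x : R) : 0 <= x -> Cmod (RtoC x) = x.
Proof. intros; rewrite Cmod_R; now apply Rabs_pos_eq. Qed.

Lemma Cmod_combination_le (x y u v : C) :
  Cmod u <= 1 -> Cmod v <= 1 -> Cmod (x * u + y * v)%C <= Cmod x + Cmod y.
Proof.
  intros Hu Hv; eapply Rle_trans; [apply Cmod_triangle|].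
  rewrite !Cmod_mult.
  generalize (Cmod_ge_0 x) (Cmod_ge_0 y); nra.
Qed.

Lemma Cmod_le_of_scaled (x M : R) (z y : C) :
  0 < x -> (RtoC x * z)%C = y -> Cmod y <= M -> Cmod z <= 1 / x * M.
Proof.
  intros Hx <-; rewrite Cmod_mult, Cmod_nonneg_R by lra; intros H.
  apply (Rmult_le_reg_l x); [exact Hx|].
  replace (x * (1 / x * M)) with M by (field; lra); exact H.
Qed.

(** This replaces the trivial bound [|P1| <= 1] and is the better one exactly when
    [(1 + lam) B1 <= |D|]: it separates the two cases of the theorem. *)
Lemma P1_bound (lam B1 : R) (D P1 P2 Q2 : C) :
  0 <= lam -> 0 < B1 -> D <> RtoC 0 -> Cmod P2 <= 1 -> Cmod Q2 <= 1 ->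
  (2 * D * P1 ^ 2 = (1 + lam) * B1 * (P2 + Q2))%C ->
  Cmod P1 ^ 2 <= (1 + lam) * B1 / Cmod D.
Proof.
  intros Hl HB HD HP HQ E.
  assert (HD' : 0 < Cmod D) by now apply Cmod_gt_0.
  apply (proj1 (Rle_div_r _ _ _ HD')).
  apply (f_equal Cmod) in E.
  assert (Hc : ((1 + lam) * B1)%C = RtoC ((1 + lam) * B1)).
  { now rewrite RtoC_mult, RtoC_plus. }
  assert (Hp : 0 <= (1 + lam) * B1) by (apply Rmult_le_pos; lra).
  rewrite Hc, !Cmod_mult, Cmod_pow, (Cmod_nonneg_R 2), (Cmod_nonneg_R _ Hp) in E by lra.
  assert (H2 : Cmod (P2 + Q2)%C <= 2) by (eapply Rle_trans; [apply Cmod_triangle | lra]).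
  apply (Rmult_le_compat_l ((1 + lam) * B1)) in H2; [lra | exact Hp].
Qed.

(** Here [a2^2] and [a3 - a2^2] are eliminated in favour of [P2] and [Q2]. *)
Lemma a3_first_bound (lam B1 : R) (B2 B3 a2 a3 a4 P1 P2 P3 Q1 Q2 Q3 : C) :
  0 <= lam -> 0 < B1 ->
  M_relations lam B1 B2 B3 a2 a3 a4 P1 P2 P3 ->
  M_relations lam B1 B2 B3 (- a2)%C (2 * a2 ^ 2 - a3)%C
    (- (5) * a2 ^ 3 + 5 * a2 * a3 - a4)%C Q1 Q2 Q3 ->
  let D := (B1 ^ 2 + (1 + lam) * (B1 - B2))%C in
  D <> RtoC 0 ->
  Cmod a3 <=
    B1 / (4 * (1 + 2 * lam) * (1 + lam) * Cmod D)
    * (Cmod ((3 + 5 * lam) * B1 ^ 2 + (1 + lam) ^ 2 * (B1 - B2))%C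
       + Cmod ((1 + 3 * lam) * B1 ^ 2 - (1 + lam) ^ 2 * (B1 - B2))%C).
Proof.
  intros Hl HB HM HN D HD.
  destruct (bi_relations _ _ _ _ _ _ _ _ _ _ _ _ _ HB HM HN) as [HQ [I3 [I4 _]]].
  destruct HM as [[_ [HP2 _]] [E1 _]], HN as [[_ [HQ2 _]] _].
  set (G1 := ((3 + 5 * lam) * B1 ^ 2 + (1 + lam) ^ 2 * (B1 - B2))%C).
  set (G2 := ((1 + 3 * lam) * B1 ^ 2 - (1 + lam) ^ 2 * (B1 - B2))%C).
  assert (HD' : 0 < Cmod D) by now apply Cmod_gt_0.
  assert (Hid : (RtoC (4 * (1 + 2 * lam) * (1 + lam)) * (D * a3) = B1 * (G1 * P2 + G2 * Q2))%C).
  { assert (HL : RtoC (1 + lam) <> RtoC 0) by (apply RtoC_neq_0; lra).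
    rewrite RtoC_plus in HL.
    rewrite !RtoC_mult, !RtoC_plus, RtoC_mult.
    assert (Ea : a2 = (B1 * P1 / (1 + lam))%C) by (rewrite <- E1; field; exact HL).
    fold D in I4.
    transitivity ((1 + lam) * D * (4 * (1 + 2 * lam) * (a3 - a2 ^ 2))
                  + 2 * (1 + 2 * lam) * (1 + lam) * a2 ^ 2 * (2 * D))%C; [ring|].
    rewrite I3, Ea.
    transitivity ((1 + lam) * D * (B1 * (P2 - Q2))
       + 2 * (1 + 2 * lam) * B1 ^ 2 / (1 + lam) * (2 * D * P1 ^ 2))%C;
      [field; exact HL|].
    rewrite I4; unfold G1, G2, D; field; exact HL. }
  apply (Cmod_le_of_scaled _ (B1 * (Cmod G1 + Cmod G2))) in Hid; [|nra|].
  - rewrite Cmod_mult in Hid.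
    apply (Rmult_le_reg_l (Cmod D)); [exact HD'|].
    eapply Rle_trans; [exact Hid|].
    right; field; repeat split; lra.
  - rewrite Cmod_mult, Cmod_nonneg_R by lra.
    apply Rmult_le_compat_l; [lra | now apply Cmod_combination_le].
Qed.

(** Here only the relation of [f] itself is used, with [a2] replaced by [P1]; [x] is
    the available bound on [|P1|^2]. *)
Lemma a3_second_bound (lam B1 x : R) (B2 B3 a2 a3 a4 P1 P2 P3 : C) :
  0 <= lam -> 0 < B1 ->
  M_relations lam B1 B2 B3 a2 a3 a4 P1 P2 P3 -> Cmod P1 ^ 2 <= x ->
  Cmod a3 <=
    1 / (2 * (1 + 2 * lam) * (1 + lam) ^ 2)
    * (x * Cmod ((1 + 3 * lam) * B1 ^ 2 - (1 + lam) ^ 2 * (B1 - B2))%C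
       + B1 * (1 + lam) ^ 2).
Proof.
  intros Hl HB [[_ [HP2 _]] [E1 [E2 _]]] Hx.
  set (G2 := ((1 + 3 * lam) * B1 ^ 2 - (1 + lam) ^ 2 * (B1 - B2))%C).
  assert (HL2 : 0 < (1 + lam) ^ 2) by (apply pow_lt; lra).
  apply (Cmod_le_of_scaled _ _ _ (P1 ^ 2 * G2 + RtoC (B1 * (1 + lam) ^ 2) * P2)%C).
  - nra.
  - rewrite !RtoC_mult, !RtoC_pow, !RtoC_plus, RtoC_mult.
    apply Ceq_minus; apply Ceq_minus in E1, E2.
    match type of E1 with ?Z = _ => match type of E2 with ?X = _ =>
      transitivity ((1 + lam) ^ 2 * X + (1 + 3 * lam) * Z * ((1 + lam) * a2 + B1 * P1))%C;
      [unfold G2; ring | rewrite E1, E2; ring] end end.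
  - eapply Rle_trans; [apply Cmod_triangle|].
    rewrite !Cmod_mult, Cmod_pow, Cmod_nonneg_R by nra.
    apply Rplus_le_compat; [apply Rmult_le_compat_r; [apply Cmod_ge_0 | exact Hx]|].
    assert (0 < B1 * (1 + lam) ^ 2) by nra; nra.
Qed.

Definition A1_coef (lam B1 : R) (B2 B3 D : C) : C :=
  ((B2 - B1)
     + 3 * (1 + 5 * lam) * B1 ^ 2 / (8 * (1 + lam) * (1 + 2 * lam))
     + B1 * (1 + lam) / (4 * D)
       * ((B1 + B3 - 2 * B2)
          + 2 * (1 + 4 * lam) * B1 ^ 3 / (1 + lam) ^ 3))%C.

Definition C1_coef (lam B1 : R) (B2 B3 D : C) : C :=
    (- (3 * (1 + 5 * lam) * B1 ^ 2 / (8 * (1 + lam) * (1 + 2 * lam)))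
     + B1 * (1 + lam) / (4 * D)
       * ((B1 + B3 - 2 * B2)
          + 2 * (1 + 4 * lam) * B1 ^ 3 / (1 + lam) ^ 3))%C.

(** The third-order relation of [f] is cubic in [P1]; one factor [P1^2] is traded for
    [P2 + Q2], which leaves
    [3 (1 + 3 lam) a4 = B1 P3 + 2 P1 (A1 P2 + C1 Q2)]. *)
Lemma a4_first_bound (lam B1 s : R) (B2 B3 a2 a3 a4 P1 P2 P3 Q1 Q2 Q3 : C) :
  0 <= lam -> 0 < B1 ->
  M_relations lam B1 B2 B3 a2 a3 a4 P1 P2 P3 ->
  M_relations lam B1 B2 B3 (- a2)%C (2 * a2 ^ 2 - a3)%C
    (- (5) * a2 ^ 3 + 5 * a2 * a3 - a4)%C Q1 Q2 Q3 ->
  let D := (B1 ^ 2 + (1 + lam) * (B1 - B2))%C in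
  D <> RtoC 0 -> Cmod P1 <= s ->
  Cmod a4 <= 1 / (3 * (1 + 3 * lam))
    * (B1 + 2 * s * (Cmod (A1_coef lam B1 B2 B3 D) + Cmod (C1_coef lam B1 B2 B3 D))).
Proof.
  intros Hl HB HM HN D HD Hs.
  destruct (bi_relations _ _ _ _ _ _ _ _ _ _ _ _ _ HB HM HN) as [HQ [I3 [I4 _]]].
  destruct HM as [[_ [HP2 HP3]] [E1 [E2 E3]]], HN as [[_ [HQ2 _]] _].
  set (A1 := A1_coef _ _ _ _ _); set (C1 := C1_coef _ _ _ _ _).
  apply (Cmod_le_of_scaled _ _ _ (B1 * P3 + 2 * P1 * (A1 * P2 + C1 * Q2))%C); [lra| |].
  - assert (HL : RtoC (1 + lam) <> RtoC 0) by (apply RtoC_neq_0; lra).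
    assert (HL2 : RtoC (1 + 2 * lam) <> RtoC 0) by (apply RtoC_neq_0; lra).
    assert (HB' : RtoC B1 <> RtoC 0) by (apply RtoC_neq_0; lra).
    rewrite RtoC_plus in HL; rewrite RtoC_plus, RtoC_mult in HL2.
    rewrite !RtoC_mult, !RtoC_plus, RtoC_mult.
    assert (HB2 : B2 = (B1 - (D - B1 ^ 2) / (1 + lam))%C)
      by (unfold D; field; exact HL).
    assert (Ea2 : a2 = (B1 * P1 / (1 + lam))%C) by (rewrite <- E1; field; exact HL).
    assert (EQ2 : Q2 = (2 * D * P1 ^ 2 / ((1 + lam) * B1) - P2)%C).
    { unfold D; rewrite I4; field; auto. }
    assert (Ea3 : a3 = (a2 ^ 2 + B1 * (P2 - Q2) / (4 * (1 + 2 * lam)))%C).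
    { rewrite <- I3; field; auto. }
    assert (E3' : (3 * (1 + 3 * lam) * a4 = 3 * (1 + 5 * lam) * a2 * a3 - (1 + 7 * lam) * a2 ^ 3
       + (B1 * P3 + 2 * (B2 - B1) * P1 * P2 + (B1 - 2 * B2 + B3) * P1 ^ 3))%C).
    { rewrite <- E3; ring. }
    rewrite E3', Ea3, Ea2; unfold A1, C1, A1_coef, C1_coef.
    clearbody D; rewrite EQ2, HB2; field; auto.
  - eapply Rle_trans; [apply Cmod_triangle|].
    rewrite !Cmod_mult, !Cmod_nonneg_R by lra.
    apply Rplus_le_compat; [generalize (Cmod_ge_0 P3); nra|].
    apply Rmult_le_compat; try apply Cmod_ge_0.
    + apply Rmult_le_pos; [lra | apply Cmod_ge_0].
    + lra.
    + now apply Cmod_combination_le.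
Qed.

(** Here [a4] comes from the difference of the two third-order relations, and
    [P1 (P2 - Q2)] is traded for [P3 + Q3], at the cost of the denominator [E]. *)
Lemma a4_second_bound (lam B1 s : R) (B2 B3 a2 a3 a4 P1 P2 P3 Q1 Q2 Q3 : C) :
  0 <= lam -> 0 < B1 ->
  M_relations lam B1 B2 B3 a2 a3 a4 P1 P2 P3 ->
  M_relations lam B1 B2 B3 (- a2)%C (2 * a2 ^ 2 - a3)%C
    (- (5) * a2 ^ 3 + 5 * a2 * a3 - a4)%C Q1 Q2 Q3 ->
  let D := (B1 ^ 2 + (1 + lam) * (B1 - B2))%C in
  let E := ((9 + 15 * lam) * B1 ^ 2
                - 8 * (1 + 2 * lam) * (1 + lam) * (B2 - B1))%C in
  D <> RtoC 0 -> E <> RtoC 0 -> Cmod P1 <= s ->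
  Cmod a4 <= 1 / (3 * (1 + 3 * lam))
    * (B1
       * (Cmod (((12 + 30 * lam) * B1 ^ 2
                 - 4 * (1 + lam) * (1 + 2 * lam) * (B2 - B1)) / E)%C
          + Cmod ((4 * (1 + lam) * (1 + 2 * lam) * (B2 - B1)
                   + 3 * B1 ^ 2 * (1 + 5 * lam)) / E)%C)
       + 2 * s
         * Cmod (B2 - B1
                 + B1 * ((B1 + B3 - 2 * B2) * (1 + lam) ^ 3
                         + 2 * (1 + 4 * lam) * B1 ^ 3)
                   / (2 * (1 + lam) ^ 2 * D))%C).
Proof.
  intros Hl HB HM HN D E HD HE Hs.
  destruct (bi_relations _ _ _ _ _ _ _ _ _ _ _ _ _ HB HM HN) as [HQ [I3 [I4 I5]]].
  destruct HM as [[_ [HP2 HP3]] [E1 [E2 E3]]], HN as [[_ [HQ2 HQ3]] [_ [_ F3]]].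
  set (X := (_ / E)%C); set (Y := (_ / E)%C); set (Z := (_ - _ + _)%C).
  apply (Cmod_le_of_scaled _ _ _ (B1 * (X * P3 + Y * Q3) + P1 * (Z * P2 + Z * Q2))%C); [lra| |].
  - assert (HL : RtoC (1 + lam) <> RtoC 0) by (apply RtoC_neq_0; lra).
    assert (HL2 : RtoC (1 + 2 * lam) <> RtoC 0) by (apply RtoC_neq_0; lra).
    assert (HB' : RtoC B1 <> RtoC 0) by (apply RtoC_neq_0; lra).
    rewrite RtoC_plus in HL; rewrite RtoC_plus, RtoC_mult in HL2.
    rewrite !RtoC_mult, !RtoC_plus, RtoC_mult.
    (* the numerators of X and Y are (T + E) / 2 and (T - E) / 2 *)
    set (T := (15 * (1 + 3 * lam) * B1 ^ 2)%C).
    assert (HX : X = (T / (2 * E) + 1 / 2)%C).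
    { unfold X; transitivity (((T + E) / 2) / E)%C; [|field; exact HE].
      f_equal; unfold T, E; field. }
    assert (HY : Y = (T / (2 * E) - 1 / 2)%C).
    { unfold Y; transitivity (((T - E) / 2) / E)%C; [|field; exact HE].
      f_equal; unfold T, E; field. }
    fold E in I5.
    assert (HPQ : (B1 * (X * P3 + Y * Q3)
       = B1 * (P3 - Q3) / 2 + T * (P1 * (P2 - Q2)) / (8 * (1 + lam) * (1 + 2 * lam)))%C).
    { rewrite HX, HY; clearbody E.
      transitivity (B1 * (P3 - Q3) / 2 + T / (2 * E) / (4 * (1 + lam) * (1 + 2 * lam))
         * (4 * (1 + lam) * (1 + 2 * lam) * B1 * (P3 + Q3)))%C; [field; auto|].
      rewrite <- I5; field; auto. }
    rewrite HPQ; unfold T, Z; clear HPQ HX HY X Y Z I5 HE E T.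
    assert (HB2 : B2 = (B1 - (D - B1 ^ 2) / (1 + lam))%C)
      by (unfold D; field; exact HL).
    assert (Ea2 : a2 = (B1 * P1 / (1 + lam))%C) by (rewrite <- E1; field; exact HL).
    assert (EQ2 : Q2 = (2 * D * P1 ^ 2 / ((1 + lam) * B1) - P2)%C).
    { unfold D; rewrite I4; field; auto. }
    assert (Ea3 : a3 = (a2 ^ 2 + B1 * (P2 - Q2) / (4 * (1 + 2 * lam)))%C).
    { rewrite <- I3; field; auto. }
    subst Q1.
    assert (Ediff : (3 * (1 + 3 * lam) * a4 =
       (15 * (1 + 3 * lam) * a2 * a3 - (11 + 29 * lam) * a2 ^ 3
        + B1 * (P3 - Q3) + 2 * (B2 - B1) * P1 * (P2 + Q2)
        + 2 * (B1 - 2 * B2 + B3) * P1 ^ 3) / 2)%C).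
    { apply Ceq_minus; apply Ceq_minus in E3, F3.
      match type of E3 with ?U = _ => match type of F3 with ?V = _ =>
        transitivity ((U - V) / 2)%C; [field | rewrite E3, F3; field] end end. }
    rewrite Ediff, Ea3, Ea2.
    clearbody D; rewrite EQ2, HB2; field; auto.
  - eapply Rle_trans; [apply Cmod_triangle|].
    rewrite !Cmod_mult, Cmod_nonneg_R by lra.
    apply Rplus_le_compat.
    + apply Rmult_le_compat_l; [lra | now apply Cmod_combination_le].
    + replace (2 * s * Cmod Z) with (s * (Cmod Z + Cmod Z)) by ring.
      apply Rmult_le_compat; try apply Cmod_ge_0; [exact Hs|].
      now apply Cmod_combination_le.
Qed.

Lemma min_entry_le (v w : R) (den : C) :
  (den <> RtoC 0 -> v <= w) -> Rbar_le v (min_entry den w).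
Proof.
  intros H; unfold min_entry; destruct (Ceq_dec den (RtoC 0)); simpl; auto.
Qed.

Lemma scaled_min_entry_le (k v w1 w2 : R) (den1 den2 : C) :
  0 < k -> (den1 <> RtoC 0 -> v <= k * w1) -> (den2 <> RtoC 0 -> v <= k * w2) ->
  Rbar_le v (Rbar_mult k (Rbar_min (min_entry den1 w1) (min_entry den2 w2))).
Proof.
  intros Hk H1 H2.
  assert (Hinf : Rbar_mult k p_infty = p_infty).
  { simpl; destruct (Rle_dec 0 k) as [Hle|Hn]; [|lra].
    destruct (Rle_lt_or_eq_dec 0 k Hle); [reflexivity | lra]. }
  apply (Rbar_min_case _ _ (fun m => Rbar_le v (Rbar_mult k m))); unfold min_entry.
  - destruct (Ceq_dec den1 (RtoC 0)); [now rewrite Hinf | simpl; auto].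
  - destruct (Ceq_dec den2 (RtoC 0)); [now rewrite Hinf | simpl; auto].
Qed.

Theorem theorem2p8 :
  forall (lam : R) (phi : C -> C) (B : nat -> C) (B1 : R)
         (f : C -> C) (a : nat -> C),
  0 <= lam ->
  univalent phi ->
  (forall z : C, in_disk z -> 0 < Re (phi z)) ->
  taylor_on_disk phi B ->
  B 0%nat = RtoC 1 ->
  B 1%nat = RtoC B1 ->
  0 < B1 ->
  taylor_on_disk f a ->
  a 0%nat = RtoC 0 ->
  a 1%nat = RtoC 1 ->
  class_M_sigma lam phi f ->
  let B2 : C := B 2%nat in
  let B3 : C := B 3%nat in
  let D : C := (B1 ^ 2 + (1 + lam) * (B1 - B2))%C in
  let E : C := ((9 + 15 * lam) * B1 ^ 2
                - 8 * (1 + 2 * lam) * (1 + lam) * (B2 - B1))%C in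
  let A1 : C :=
    ((B2 - B1)
     + 3 * (1 + 5 * lam) * B1 ^ 2 / (8 * (1 + lam) * (1 + 2 * lam))
     + B1 * (1 + lam) / (4 * D)
       * ((B1 + B3 - 2 * B2)
          + 2 * (1 + 4 * lam) * B1 ^ 3 / (1 + lam) ^ 3))%C in
  let C1 : C :=
    (- (3 * (1 + 5 * lam) * B1 ^ 2 / (8 * (1 + lam) * (1 + 2 * lam)))
     + B1 * (1 + lam) / (4 * D)
       * ((B1 + B3 - 2 * B2)
          + 2 * (1 + 4 * lam) * B1 ^ 3 / (1 + lam) ^ 3))%C in
  ((1 + lam) * B1 <= Cmod D ->
     Cmod (a 2%nat) <= B1 * sqrt B1 / sqrt ((1 + lam) * Cmod D)
     /\
     Cmod (a 3%nat) <=
       B1 / (2 * (1 + 2 * lam) * (1 + lam) * Cmod D)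
       * Rmin
           (1 / 2
            * (Cmod ((3 + 5 * lam) * B1 ^ 2 + (1 + lam) ^ 2 * (B1 - B2))%C
               + Cmod ((1 + 3 * lam) * B1 ^ 2 - (1 + lam) ^ 2 * (B1 - B2))%C))
           (Cmod ((1 + 3 * lam) * B1 ^ 2 - (1 + lam) ^ 2 * (B1 - B2))%C
            + Cmod ((1 + lam) * B1 ^ 2 + (1 + lam) ^ 2 * (B1 - B2))%C)
     /\
     Rbar_le (Finite (Cmod (a 4%nat)))
       (Rbar_mult (Finite (1 / (3 * (1 + 3 * lam))))
          (Rbar_min
             (min_entry D
                (B1 + 2 * sqrt ((1 + lam) * B1) / sqrt (Cmod D)
                      * (Cmod A1 + Cmod C1)))
             (min_entry (D * E)%C
                (B1
                 * (Cmod (((12 + 30 * lam) * B1 ^ 2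
                           - 4 * (1 + lam) * (1 + 2 * lam) * (B2 - B1)) / E)%C
                    + Cmod ((4 * (1 + lam) * (1 + 2 * lam) * (B2 - B1)
                             + 3 * B1 ^ 2 * (1 + 5 * lam)) / E)%C)
                 + 2 * sqrt ((1 + lam) * B1) / sqrt (Cmod D)
                   * Cmod (B2 - B1
                           + B1 * ((B1 + B3 - 2 * B2) * (1 + lam) ^ 3
                                   + 2 * (1 + 4 * lam) * B1 ^ 3)
                             / (2 * (1 + lam) ^ 2 * D))%C)))))
  /\
  (Cmod D <= (1 + lam) * B1 ->
     Cmod (a 2%nat) <= B1 / (1 + lam)
     /\
     Rbar_le (Finite (Cmod (a 3%nat)))
       (Rbar_min
          (min_entry D
             (B1 / (4 * (1 + 2 * lam) * (1 + lam) * Cmod D)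
              * (Cmod ((3 + 5 * lam) * B1 ^ 2 + (1 + lam) ^ 2 * (B1 - B2))%C
                 + Cmod ((1 + 3 * lam) * B1 ^ 2
                         - (1 + lam) ^ 2 * (B1 - B2))%C)))
          (Finite
             (1 / (2 * (1 + 2 * lam) * (1 + lam) ^ 2)
              * (Cmod ((1 + 3 * lam) * B1 ^ 2 - (1 + lam) ^ 2 * (B1 - B2))%C
                 + B1 * (1 + lam) ^ 2))))
     /\
     Rbar_le (Finite (Cmod (a 4%nat)))
       (Rbar_mult (Finite (1 / (3 * (1 + 3 * lam))))
          (Rbar_min
             (min_entry D (B1 + 2 * (Cmod A1 + Cmod C1)))
             (min_entry (D * E)%C
                (B1
                 * (Cmod (((12 + 30 * lam) * B1 ^ 2
                           - 4 * (1 + lam) * (1 + 2 * lam) * (B2 - B1)) / E)%C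
                    + Cmod ((4 * (1 + lam) * (1 + 2 * lam) * (B2 - B1)
                             + 3 * B1 ^ 2 * (1 + 5 * lam)) / E)%C)
                 + 2 * Cmod (B2 - B1
                             + B1 * ((B1 + B3 - 2 * B2) * (1 + lam) ^ 3
                                     + 2 * (1 + 4 * lam) * B1 ^ 3)
                               / (2 * (1 + lam) ^ 2 * D))%C))))).
Proof.
  intros lam phi B B1 f a Hlam _ _ Hphi HB0 HB1 HB Hf Ha0 Ha1
    [_ [HMf [g [[[Hga _] [r [Hr Hfg]]] HMg]]]] B2 B3 D E A1 C1.
  assert (Hfp := near_pseries_of_taylor _ _ Hf).
  destruct (near_pseries_of_analytic_0 g Hga) as [b Hgp].
  assert (Hb0 : b O = RtoC 0).
  { destruct HMg as [[_ [Hg0 _]] _].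
    now rewrite <- (jet_head _ _ _ (near_pseries_jet 1 _ _ Hgp)). }
  destruct (inverse_coefficients f g a b Hfp Hgp Ha0 Ha1 Hb0) as [Hb1 [Hb2 [Hb3 Hb4]]].
  { exists r; split; [exact Hr | intros t Ht; now apply Hfg]. }
  destruct (class_M_relations lam B1 phi f B a Hphi HB0 HB1 Hfp Ha0 Ha1 HMf)
    as [P1 [P2 [P3 HM]]].
  destruct (class_M_relations lam B1 phi g B b Hphi HB0 HB1 Hgp Hb0 Hb1 HMg)
    as [Q1 [Q2 [Q3 HN]]].
  rewrite Hb2, Hb3, Hb4 in HN.
  fold B2 B3 in HM, HN.
  clear - Hlam HB HM HN.
  set (a2 := a 2%nat) in *; set (a3 := a 3%nat) in *; set (a4 := a 4%nat) in *.
  assert (HP1 : Cmod P1 <= 1) by apply HM.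
  assert (Ha2 : Cmod a2 = B1 / (1 + lam) * Cmod P1).
  { destruct HM as [_ [E1 _]].
    apply (f_equal Cmod) in E1; rewrite !Cmod_mult, <- RtoC_plus, !Cmod_nonneg_R in E1 by lra.
    apply (Rmult_eq_reg_l (1 + lam)); [rewrite E1; field|]; lra. }
  assert (HP1D : D <> RtoC 0 -> Cmod P1 ^ 2 <= (1 + lam) * B1 / Cmod D).
  { intros HD; destruct (bi_relations _ _ _ _ _ _ _ _ _ _ _ _ _ HB HM HN) as [_ [_ [I4 _]]].
    apply (P1_bound lam B1 D P1 P2 Q2); auto; [apply HM | apply HN]. }
  split.
  - intros HDl.
    assert (Hpos : 0 < (1 + lam) * B1) by (apply Rmult_lt_0_compat; lra).
    assert (HD' : 0 < Cmod D) by lra.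
    assert (HD : D <> RtoC 0) by now apply Cmod_gt_0.
    specialize (HP1D HD).
    assert (HP1s : Cmod P1 <= sqrt ((1 + lam) * B1) / sqrt (Cmod D)).
    { rewrite <- sqrt_div by lra.
      rewrite <- (sqrt_pow2 (Cmod P1)) by apply Cmod_ge_0.
      now apply sqrt_le_1_alt. }
    replace (2 * sqrt ((1 + lam) * B1) / sqrt (Cmod D))
      with (2 * (sqrt ((1 + lam) * B1) / sqrt (Cmod D))) by (unfold Rdiv; ring).
    split; [|split].
    + rewrite Ha2.
      apply Rle_trans with (B1 / (1 + lam) * (sqrt ((1 + lam) * B1) / sqrt (Cmod D))).
      * apply Rmult_le_compat_l; [apply Rlt_le, Rdiv_lt_0_compat; lra | exact HP1s].
      * right; rewrite !sqrt_mult by lra.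
        assert (Hl : sqrt (1 + lam) * sqrt (1 + lam) = 1 + lam) by (apply sqrt_sqrt; lra).
        assert (0 < sqrt (1 + lam)) by (apply sqrt_lt_R0; lra).
        assert (0 < sqrt (Cmod D)) by (apply sqrt_lt_R0; lra).
        rewrite <- Hl at 1; field; lra.
    + apply Rmin_case.
      * eapply Rle_trans; [apply (a3_first_bound lam B1 B2 B3 a2 a3 a4 P1 P2 P3 Q1 Q2 Q3); auto|].
        fold D; right; field; lra.
      * eapply Rle_trans;
          [apply (a3_second_bound lam B1 _ B2 B3 a2 a3 a4 P1 P2 P3 Hlam HB HM HP1D)|].
        assert (EG : Cmod ((1 + lam) * B1 ^ 2 + (1 + lam) ^ 2 * (B1 - B2))%C
                     = (1 + lam) * Cmod D).
        { rewrite <- (Cmod_nonneg_R (1 + lam)) at 1 by lra.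
          rewrite <- Cmod_mult; f_equal; rewrite RtoC_plus; unfold D; ring. }
        rewrite EG; right; field; lra.
    + apply scaled_min_entry_le; [apply Rdiv_lt_0_compat; lra | |].
      * intros _; now apply (a4_first_bound lam B1 _ B2 B3 a2 a3 a4 P1 P2 P3 Q1 Q2 Q3).
      * intros HDE; apply (a4_second_bound lam B1 _ B2 B3 a2 a3 a4 P1 P2 P3 Q1 Q2 Q3); auto.
        fold E; intros HE; apply HDE; rewrite HE; ring.
  - intros _.
    split; [|split].
    + rewrite Ha2; rewrite <- (Rmult_1_r (B1 / (1 + lam))) at 2.
      apply Rmult_le_compat_l; [apply Rlt_le, Rdiv_lt_0_compat; lra | exact HP1].
    + apply (Rbar_min_case _ _ (fun m => Rbar_le (Cmod a3) m)).
      * apply min_entry_le; intros HD.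
        now apply (a3_first_bound lam B1 B2 B3 a2 a3 a4 P1 P2 P3 Q1 Q2 Q3).
      * assert (HP2 : Cmod P1 ^ 2 <= 1).
        { rewrite <- (pow1 2); apply pow_incr; split; [apply Cmod_ge_0 | exact HP1]. }
        assert (Hb := a3_second_bound lam B1 _ B2 B3 a2 a3 a4 P1 P2 P3 Hlam HB HM HP2).
        rewrite Rmult_1_l in Hb; exact Hb.
    + apply scaled_min_entry_le; [apply Rdiv_lt_0_compat; lra | |].
      * intros HD.
        assert (Hb := a4_first_bound lam B1 1 B2 B3 a2 a3 a4 P1 P2 P3 Q1 Q2 Q3
                        Hlam HB HM HN HD HP1).
        rewrite Rmult_1_r in Hb; exact Hb.
      * intros HDE.
        assert (HD : D <> RtoC 0) by (intros H; apply HDE; rewrite H; ring).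
        assert (HE : E <> RtoC 0) by (intros H; apply HDE; rewrite H; ring).
        assert (Hb := a4_second_bound lam B1 1 B2 B3 a2 a3 a4 P1 P2 P3 Q1 Q2 Q3
                        Hlam HB HM HN HD HE HP1).
        rewrite Rmult_1_r in Hb; exact Hb.
Qed.
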